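(* Let $n\geq 2$. A map $\tau\colon\mathcal{PC}^n\to\mathcal{PC}^n$ satisfies $$\tau(K\land L)=\tau(K)\lor\tau(L)\quad\text{and}\quad \tau(K\lor L)=\tau(K)\land\tau(L)$$ for all $K,L\in\mathcal{PC}^n$ if and only if either $\tau$ is constant, or there exists $g\in\mathrm{GL}(n)$ such that $\tau(K)=g(K^\ast)$ for all $K\in\mathcal{PC}^n$.
   Context: We work in Euclidean space $\mathbb{R}^n$ with standard inner product $\langle\cdot,\cdot\rangle$; $o$ is the origin. A (convex) pseudo-cone is a nonempty convex set $K\subset\mathbb{R}^n$ with $o\notin K$ such that $\lambda x\in K$ for all $x\in K$ and all real $\lambda\geq 1$. Put $$\mathcal{PC}^n=\{K\subset\mathbb{R}^n: K\text{ is a closed pseudo-cone, or }K=\emptyset,\text{ or }K=\mathbb{R}^n\}.$$ Ordered by inclusion, $\mathcal{PC}^n$ is a lattice with operations $K\land L=K\cap L$, and $K\lor L=\mathrm{cl}[K,L]$ if $o\notin\mathrm{cl}[K,L]$, $K\lor L=\mathbb{R}^n$ if $o\in\mathrm{cl}[K,L]$, where $\mathrm{cl}[K,L]$ is the closure of the convex hull $[K,L]$ of $K\cup L$. For a closed pseudo-cone $K$, $K^\ast=\{x\in\mathbb{R}^n:\langle x,y\rangle\leq -1\text{ for all }y\in K\}$; moreover $\emptyset^\ast=\mathbb{R}^n$ and $(\mathbb{R}^n)^\ast=\emptyset$. $\mathrm{GL}(n)$ is the group of invertible linear maps of $\mathbb{R}^n$, and $g(K)$ is the image of $K$ under $g$.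 *)

(* Defs.v *)
From HB Require Import structures.
From mathcomp Require Import all_boot all_order all_algebra.
From mathcomp Require Import all_classical all_reals all_analysis.

Set Implicit Arguments.
Unset Strict Implicit.
Unset Printing Implicit Defensive.

Import Order.TTheory GRing.Theory Num.Theory.
Import numFieldNormedType.Exports.

Local Open Scope classical_set_scope.
Local Open Scope ring_scope.

Section PseudoCones.
Context {R : realType} {n : nat}.
Local Notation V := 'rV[R]_n.
Implicit Types (A : set V) (x y : V).

Definition dot x y : R := \sum_(i < n) x 0 i * y 0 i.

Definition convex_subset A : Prop := @convex_set R V A.

Definition convex_hull A : set V := smallest convex_subset A.

Definition pseudo_cone A : Prop :=
  [/\ A !=set0, convex_subset A, ~ A 0 &
      forall x (l : R), A x -> 1 <= l -> A (l *: x)].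

Definition in_PC A : Prop :=
  [\/ pseudo_cone A /\ closed A, A = set0 | A = setT].

(* For [set0] and [setT] this formula gives the conventional values [setT] and
   [set0]: see [dual_set_set0] and [dual_set_setT]. *)
Definition dual_set A : set V := [set x | forall y, A y -> dot x y <= -1].

Definition cl_hull (A B : set V) : set V := closure (convex_hull (A `|` B)).

Definition join_set (A B : set V) : set V :=
  if `[< cl_hull A B 0 >] then setT else cl_hull A B.

Lemma dual_set_set0 : dual_set set0 = setT.
Proof. by apply/seteqP; split => // x _ y. Qed.

Lemma dual_set_setT : dual_set setT = set0.
Proof.
apply/seteqP; split => // x /(_ 0 I).
have -> : dot x 0 = 0 by apply: big1 => i _; rewrite mxE mulr0.
by rewrite lerNr oppr0 ler10.
Qed.

Lemma convex_subsetP A : convex_subset A <->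
  forall x y (t : R), A x -> A y -> 0 <= t <= 1 -> A (t *: x + (1 - t) *: y).
Proof.
split=> [cA x y t Ax Ay /andP[t0 t1]|cA x y t /set_mem Ax /set_mem Ay].
  have /set_mem := cA x y (Itv01 t0 t1) (mem_set Ax) (mem_set Ay).
  exact.
by apply/mem_set/cA => //; rewrite ge0 le1.
Qed.

Lemma convex_hull_convex A : convex_subset (convex_hull A).
Proof.
apply/convex_subsetP => x y t hx hy t01 B BP.
by have /convex_subsetP cB := BP.1; apply: cB => //; [exact: hx | exact: hy].
Qed.

Lemma affine_continuous (a : R) (b : V) : continuous (fun x : V => a *: x + b).
Proof.
move=> z; apply: (@cvgD R V V (nbhs z)); last exact: cvg_cst.
by apply: (@cvgZ R V V (nbhs z)); [exact: cvg_cst | exact: cvg_id].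
Qed.

Lemma closure_affine A (a : R) (b : V) :
  (forall x, A x -> closure A (a *: x + b)) ->
  forall x, closure A x -> closure A (a *: x + b).
Proof.
pose f (x : V) : V := a *: x + b.
move=> Af x; suff : closure A `<=` f @^-1` closure A by exact.
have cl : closed (f @^-1` closure A).
  apply: preimage_closed; last exact: closed_closure.
  by move=> z _; exact: affine_continuous.
by have /closure_id -> := cl; exact: closureS.
Qed.

Lemma closure_convex A : convex_subset A -> convex_subset (closure A).
Proof.
move=> /convex_subsetP cA; apply/convex_subsetP => x y t clx cly t01.
apply: closure_affine clx => {}x Ax.
rewrite addrC; apply: closure_affine cly => {}y Ay.
by rewrite addrC; apply: subset_closure; exact: cA.
Qed.

Lemma in_PC_convex A : in_PC A -> convex_subset A.
Proof. by case=> [[[]]|->|->] // *; apply/convex_subsetP. Qed.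

Lemma in_PC_scale A x (l : R) : in_PC A -> A x -> 1 <= l -> A (l *: x).
Proof. by case=> [[[_ _ _ +] _]|->|->] //; exact. Qed.

Lemma in_PC_closed A : in_PC A -> closed A.
Proof.
by case=> [[]|->|->]; [ | exact: closed0 | exact: closedT].
Qed.

Lemma in_PCI A B : in_PC A -> in_PC B -> in_PC (A `&` B).
Proof.
move=> PA PB.
have [->|AT] := pselect (A = setT); first by rewrite setTI.
have [->|BT] := pselect (B = setT); first by rewrite setIT.
have [->|/eqP/set0P AB0] := pselect (A `&` B = set0); first exact: Or32.
apply: Or31; split; last by apply: closedI; exact: in_PC_closed.
split=> //.
- apply/convex_subsetP => x y t [Ax Bx] [Ay By] t01.
  have /convex_subsetP cA := in_PC_convex PA.
  have /convex_subsetP cB := in_PC_convex PB.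
  by split; [exact: cA | exact: cB].
- case: AB0 => x [Ax Bx] [A0 _].
  by case: PA => [[[]]|E|E] //; rewrite E in Ax.
- by move=> x l [Ax Bx] l1; split; exact: in_PC_scale.
Qed.

Lemma in_PC_join A B : in_PC A -> in_PC B -> in_PC (join_set A B).
Proof.
move=> PA PB; rewrite /join_set; case: asboolP => [_|C0]; first exact: Or33.
have [->|/eqP/set0P C_n0] := pselect (cl_hull A B = set0); first exact: Or32.
apply: Or31; split; last exact: closed_closure.
split; [exact: C_n0 | | exact: C0 |].
  by apply: closure_convex; exact: convex_hull_convex.
move=> x l Cx l1; rewrite -[l *: x]addr0; apply: closure_affine Cx => {}x hx.
rewrite addr0; apply: subset_closure => D [cD ABD].
suff : convex_hull (A `|` B) `<=` [set y | D (l *: y)] by exact.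
apply: smallest_sub.
  apply/convex_subsetP => u v t /= Du Dv t01.
  rewrite scalerDr !scalerA ![l * _]mulrC -!scalerA.
  by move/convex_subsetP: cD; exact.
move=> y [Ay|By] /=; apply: ABD.
  by left; exact: in_PC_scale.
by right; exact: in_PC_scale.
Qed.

End PseudoCones.

Record PC (R : realType) (n : nat) := MkPC {
  PC_set :> set 'rV[R]_n;
  PC_setP : in_PC PC_set
}.

Lemma PC_eq (R : realType) (n : nat) (K L : PC R n) :
  K = L :> set 'rV[R]_n -> K = L.
Proof.
by case: K L => [A PA] [B PB] /= E; subst B; rewrite (Prop_irrelevance PA PB).
Qed.

Definition PC_meet (R : realType) (n : nat) (K L : PC R n) : PC R n :=
  MkPC (in_PCI (PC_setP K) (PC_setP L)).

Definition PC_join (R : realType) (n : nat) (K L : PC R n) : PC R n :=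
  MkPC (in_PC_join (PC_setP K) (PC_setP L)).

(* Main.v *)
(* By the bipolar theorem, duality is an order-reversing involution of the
   lattice, so [s K := (tau K)^*] is a lattice endomorphism, and it suffices to
   show that [s] is constant or linear. Write [R_x] for the ray [{l x, l >= 1}]
   and [H_u = R_u^*] for the half-space [<u, .> <= -1].

   If [s] is not constant, it separates [R_x] from the empty set (otherwise
   [R_x], [R_(-x)], [R_y], [R_(-y)] force [s] to be constant) and from
   [R_(l x)], [l > 1] (otherwise [s R_w] does not depend on the length of [w],
   and the rays in the boundaries of a rotating half-space give an uncountable
   strict chain of closed sets). Adjoining to a simplicial cone one ray out of
   a real family yields images that meet pairwise in the image of the cone; by
   counting rational points, all but countably many of them raise the linear
   rank without spanning the space. Iterating from the empty cone and from a
   ray bounds the ranks, so that [s] fixes the empty set and, if [n >= 3], maps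
   rays to rays; if [n = 2], generic half-planes are mapped to half-planes and
   two of them through [x] show that [s R_x] is a ray. The same holds for the
   dual endomorphism, so half-spaces are mapped to half-spaces.

   The resulting maps [f] and [g] on directions preserve the incidences
   [<x, u> = -1] and [<x, u> = 0]. In suitable bases they act coordinatewise by
   a single ring endomorphism of the reals, which is the identity. *)

Require Import Defs.
From mathcomp Require Import all_boot all_order all_algebra.
From mathcomp Require Import all_classical all_reals all_analysis.
From mathcomp Require Import ring lra.

Set Implicit Arguments.
Unset Strict Implicit.
Unset Printing Implicit Defensive.
Import Order.TTheory GRing.Theory Num.Theory.
Import numFieldNormedType.Exports.
Local Open Scope classical_set_scope.
Local Open Scope ring_scope.

(** * Inner product, closed sets and simplicial cones *)

Section Basics.
Context {R : realType} {n : nat}.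
Local Notation V := 'rV[R]_n.
Implicit Types (A B K : set V) (x y u v : V).

Lemma dot_mulmx x y : dot x y = (x *m y^T) 0 0.
Proof. by rewrite /dot mxE; apply: eq_bigr => i _; rewrite mxE. Qed.

Lemma dotC x y : dot x y = dot y x.
Proof. by apply: eq_bigr => i _; rewrite mulrC. Qed.

Lemma dotDl x y v : dot (x + y) v = dot x v + dot y v.
Proof. by rewrite !dot_mulmx mulmxDl mxE. Qed.

Lemma dotZl (a : R) x v : dot (a *: x) v = a * dot x v.
Proof. by rewrite !dot_mulmx -scalemxAl mxE. Qed.

Lemma dotNl x v : dot (- x) v = - dot x v.
Proof. by rewrite -scaleN1r dotZl mulN1r. Qed.

Lemma dot0l v : dot 0 v = 0.
Proof. by rewrite -(scale0r 0) dotZl mul0r. Qed.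

Lemma dotDr x y v : dot v (x + y) = dot v x + dot v y.
Proof. by rewrite dotC dotDl !(dotC v). Qed.

Lemma dotZr (a : R) x v : dot v (a *: x) = a * dot v x.
Proof. by rewrite dotC dotZl (dotC v). Qed.

Lemma dotNr x v : dot v (- x) = - dot v x.
Proof. by rewrite dotC dotNl (dotC v). Qed.

Lemma dot0r v : dot v 0 = 0.
Proof. by rewrite dotC dot0l. Qed.

Lemma dot_deltal i v : dot (delta_mx 0 i) v = v 0 i.
Proof.
rewrite /dot (bigD1 i)//= mxE !eqxx mul1r big1 ?addr0// => j ji.
by rewrite mxE (negbTE ji) andbF mul0r.
Qed.

Lemma dot_deltar i v : dot v (delta_mx 0 i) = v 0 i.
Proof. by rewrite dotC dot_deltal. Qed.

Lemma dot_mulmxr x y (M : 'M[R]_n) : dot (x *m M) y = dot x (y *m M^T).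
Proof. by rewrite !dot_mulmx trmx_mul trmxK mulmxA. Qed.

Lemma dot_ge0 x : 0 <= dot x x.
Proof. by apply: sumr_ge0 => i _; rewrite -expr2 sqr_ge0. Qed.

Lemma dot_eq0 x : dot x x = 0 -> x = 0.
Proof.
move=> /eqP; rewrite psumr_eq0; last by move=> i _; rewrite -expr2 sqr_ge0.
move=> /allP h; apply/rowP => i; rewrite mxE.
by have := h i (mem_index_enum i); rewrite /= mulf_eq0 orbb => /eqP.
Qed.

Lemma dot_gt0 x : x != 0 -> 0 < dot x x.
Proof.
move=> x0; rewrite lt_def dot_ge0 andbT; apply: contra_neq x0.
exact: dot_eq0.
Qed.

Lemma continuous_mulmx_coord k (M : 'M[R]_(n, k)) i :
  continuous (fun v : V => (v *m M) 0 i : R).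
Proof.
rewrite [X in continuous X](_ : _ = fun v : V => \sum_(j < n) v 0 j * M j i).
  apply: (continuous_big (op := +%R)); first exact: add_continuous.
  move=> j _ v; apply: (@continuousM _ _ (fun v : V => v 0 j) (fun=> M j i)).
    exact: coord_continuous.
  exact: cst_continuous.
by apply/funext => v; rewrite mxE.
Qed.

Lemma continuous_dotl u : continuous (fun v : V => dot v u : R).
Proof.
rewrite [X in continuous X](_ : _ = fun v : V => (v *m u^T) 0 0).
  exact: continuous_mulmx_coord.
by apply/funext => v; rewrite dot_mulmx.
Qed.

Lemma closed_continuous_preimage (f : V -> R) (D : set R) :
  continuous f -> closed D -> closed [set v | D (f v)].
Proof. by move=> cf; apply: preimage_closed => v _; exact: cf. Qed.

Lemma closed_dot_le u (c : R) : closed [set v : V | dot v u <= c].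
Proof.
apply: (@closed_continuous_preimage (dot^~ u) [set r | r <= c]).
  exact: continuous_dotl.
exact: closed_le.
Qed.

Lemma closed_forall (T : topologicalType) I (P : I -> set T) :
  (forall i, closed (P i)) -> closed [set v | forall i, P i v].
Proof.
move=> cP; rewrite (_ : [set _ | _] = \bigcap_(i in setT) P i).
  exact: closed_bigI.
by apply/seteqP; split => v /= h i //; exact: h.
Qed.

Lemma in_PC0 : in_PC (set0 : set V).
Proof. exact: Or32. Qed.

Lemma in_PCT : in_PC (setT : set V).
Proof. exact: Or33. Qed.

Lemma in_PC_has0 K : in_PC K -> K 0 -> K = setT.
Proof. by case=> [[[]]|->|]. Qed.

Lemma in_PC_comb K x y (a b : R) : in_PC K -> K x -> K y ->
  0 <= a -> 0 <= b -> 1 <= a + b -> K (a *: x + b *: y).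
Proof.
move=> PK Kx Ky a0 b0 ab1; have ab0 : 0 < a + b by lra.
have -> : a *: x + b *: y = (a + b) *:
    ((a / (a + b)) *: x + (1 - a / (a + b)) *: y).
  by rewrite scalerDr !scalerA; congr (_ *: _ + _ *: _); field; rewrite gt_eqF.
apply: in_PC_scale => //; move/convex_subsetP: (in_PC_convex PK); apply => //.
by rewrite divr_ge0 ?(ltW ab0)//= ler_pdivrMr// mul1r lerDl.
Qed.

(** Every point of [K] is a recession direction of [K]: the coefficient [1] of [x] already makes the
    coefficient sum at least [1]. *)
Lemma in_PC_add_sum K x I (r : seq I) (c : I -> R) (w : I -> V) : in_PC K ->
  K x -> (forall i, 0 <= c i) -> (forall i, K (w i)) ->
  K (x + \sum_(i <- r) c i *: w i).
Proof.
move=> PK Kx c0 Kw; elim: r => [|i r IH]; first by rewrite big_nil addr0.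
rewrite big_cons addrCA addrC -[x + _]scale1r; apply: in_PC_comb => //.
by have := c0 i; lra.
Qed.

Lemma join_subl A B : A `<=` join_set A B.
Proof.
move=> x Ax; rewrite /join_set; case: asboolP => // _.
by apply: subset_closure => D [_ ABD]; apply: ABD; left.
Qed.

Lemma join_subr A B : B `<=` join_set A B.
Proof.
move=> x Ax; rewrite /join_set; case: asboolP => // _.
by apply: subset_closure => D [_ ABD]; apply: ABD; right.
Qed.

Lemma cl_hull_sub A B K : convex_subset K -> closed K ->
  A `<=` K -> B `<=` K -> cl_hull A B `<=` K.
Proof.
move=> PK CK AK BK; rewrite /cl_hull.
rewrite closureE; apply: smallest_sub => //; apply: smallest_sub => //.
by rewrite subUset.
Qed.

Lemma join_sub A B K : in_PC K -> A `<=` K -> B `<=` K -> join_set A B `<=` K.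
Proof.
move=> PK AK BK.
have h := cl_hull_sub (in_PC_convex PK) (in_PC_closed PK) AK BK.
by rewrite /join_set; case: asboolP => // /h/(in_PC_has0 PK) ->.
Qed.

(** Universal property of the join; it allows joins to be identified without computing a closed
    convex hull. *)
Lemma join_eq A B J : in_PC A -> in_PC B -> in_PC J -> A `<=` J -> B `<=` J ->
  (forall K, in_PC K -> A `<=` K -> B `<=` K -> J `<=` K) -> join_set A B = J.
Proof.
move=> PA PB PJ AJ BJ JK; apply/seteqP; split; first exact: join_sub.
by apply: JK; [exact: in_PC_join | exact: join_subl | exact: join_subr].
Qed.

(** For independent rows this is the join of the rays through the rows of [X]; [k = 0] gives the
    empty set and [k = 1] a ray. *)
Definition simplex_cone k (X : 'M[R]_(k, n)) : set V :=
  [set a *m X | a in [set a : 'rV[R]_k |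
     (forall i, 0 <= a 0 i) /\ 1 <= \sum_i a 0 i]].

(** A right inverse [Y] of [X] recovers the coefficients of [v] as [v *m Y], so the cone is cut out
    by closed conditions on linear functions of [v]; the first one puts [v] in the row space of
    [X]. *)
Lemma closed_simplex_cone k (X : 'M[R]_(k, n)) :
  row_free X -> closed (simplex_cone X).
Proof.
move=> /row_freeP[Y XY]; rewrite (_ : simplex_cone X =
  [set v | forall j, (v *m (Y *m X - 1%:M)) 0 j = 0] `&`
  ([set v | forall i, 0 <= (v *m Y) 0 i] `&`
   [set v | 1 <= (v *m (Y *m (const_mx 1 : 'cV[R]_k))) 0 0])).
  apply: closedI; [|apply: closedI].
  - apply: closed_forall => j.
    apply: (@closed_continuous_preimage _ [set 0]); last exact: closed_eq.
    exact: continuous_mulmx_coord.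
  - apply: closed_forall => j.
    apply: (@closed_continuous_preimage _ [set r | 0 <= r]).
      exact: continuous_mulmx_coord.
    exact: closed_ge.
  - apply: (@closed_continuous_preimage _ [set r | 1 <= r]).
      exact: continuous_mulmx_coord.
    exact: closed_ge.
apply/seteqP; split => v /=.
  move=> [a [a0 a1] <-]; rewrite mulmxBr mulmx1 !mulmxA.
  rewrite -(mulmxA a) XY mulmx1 subrr.
  split; first by move=> j; rewrite mxE.
  split => //; rewrite mxE; rewrite (le_trans a1)//.
  by apply: ler_sum => i _; rewrite mxE mulr1.
move=> [h1 [h2 h3]]; exists (v *m Y); last first.
  apply/eqP; rewrite -subr_eq0; apply/eqP/rowP => j.
  by rewrite -mulmxA -{2}(mulmx1 v) -mulmxBr h1 mxE.
split=> //; rewrite (le_trans h3)// mulmxA mxE.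
by apply: ler_sum => i _; rewrite [X in _ * X]mxE mulr1.
Qed.

Lemma in_PC_simplex_cone k (X : 'M[R]_(k, n)) :
  row_free X -> in_PC (simplex_cone X).
Proof.
move=> fX; have [->|/eqP/set0P X0] := pselect (simplex_cone X = set0).
  exact: in_PC0.
apply: Or31; split; last exact: closed_simplex_cone.
split => //.
- apply/convex_subsetP => _ _ t [a [a0 a1] <-] [b [b0 b1] <-] /andP[t0 t1].
  exists (t *: a + (1 - t) *: b); last by rewrite mulmxDl -!scalemxAl.
  have t1' : 0 <= 1 - t by lra.
  split=> [i|]; first by rewrite !mxE addr_ge0// mulr_ge0.
  rewrite (eq_bigr (fun i => t * a 0 i + (1 - t) * b 0 i)); last first.
    by move=> i _; rewrite !mxE.
  rewrite big_split/= -!mulr_sumr.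
  by apply: le_trans (lerD (ler_wpM2l t0 a1) (ler_wpM2l t1' b1)); lra.
- move=> [a [a0 a1]] /eqP; rewrite mulmx_free_eq0// => /eqP az.
  by move: a1; rewrite big1 ?ler10// => i _; rewrite az mxE.
- move=> _ l [a [a0 a1] <-] l1; exists (l *: a); last by rewrite -scalemxAl.
  have l0 : 0 <= l by lra.
  split=> [i|]; first by rewrite mxE mulr_ge0.
  rewrite (eq_bigr (fun i => l * a 0 i)); last by move=> i _; rewrite mxE.
  by rewrite -mulr_sumr (le_trans l1)// ler_peMr.
Qed.

Lemma simplex_cone_empty (X : 'M[R]_(0, n)) : simplex_cone X = set0.
Proof.
apply/seteqP; split => // x [a [_ +] _].
by rewrite big_ord0 ler10.
Qed.

Lemma simplex_cone_row k (X : 'M[R]_(k, n)) i : simplex_cone X (row i X).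
Proof.
exists (delta_mx 0 i); last by rewrite rowE.
split=> [j|]; first by rewrite mxE ler0n.
by rewrite (bigD1 i)//= mxE !eqxx lerDl sumr_ge0// => j _; rewrite mxE ler0n.
Qed.

Lemma simplex_cone_col_mxP k (X : 'M[R]_(k, n)) y v :
  simplex_cone (col_mx X y) v <-> exists (a : 'rV[R]_k) (b : R),
    [/\ forall i, 0 <= a 0 i, 0 <= b, 1 <= \sum_i a 0 i + b &
        v = a *m X + b *: y].
Proof.
split.
  move=> [c [c0 c1] <-]; exists (lsubmx c), (rsubmx c 0 0); split.
  - by move=> i; rewrite mxE.
  - by rewrite mxE.
  - move: c1; rewrite big_split_ord/= big_ord1.
    by rewrite (eq_bigr (fun i => lsubmx c 0 i))// ?mxE// => i _; rewrite mxE.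
  - by rewrite -mul_scalar_mx -mx11_scalar -mul_row_col hsubmxK.
move=> [a [b [a0 b0 ab1 ->]]]; exists (row_mx a b%:M); last first.
  by rewrite mul_row_col mul_scalar_mx.
split=> [i|].
  case: (split_ordP i) => j ->; rewrite ?row_mxEl ?row_mxEr//.
  by rewrite !ord1 mxE mulr1n.
rewrite big_split_ord/= big_ord1 row_mxEr mxE mulr1n.
by rewrite (eq_bigr (fun i => a 0 i))// => i _; rewrite row_mxEl.
Qed.

Definition ray x : set V := [set l *: x | l in [set l : R | 1 <= l]].

Lemma ray_simplex_cone x : ray x = simplex_cone x.
Proof.
apply/seteqP; split => v.
  move=> [l /= l1 <-]; exists l%:M; last by rewrite mul_scalar_mx.
  split=> [i|]; last by rewrite big_ord1 mxE mulr1n.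
  by rewrite ord1 mxE mulr1n; lra.
move=> [a []]; rewrite big_ord1 => a0 a1 <-; exists (a 0 0) => //.
by rewrite -mul_scalar_mx -mx11_scalar.
Qed.

Lemma row_free_rV x : x != 0 -> row_free x.
Proof. by move=> x0; rewrite /row_free rank_rV x0. Qed.

Lemma in_PC_ray x : x != 0 -> in_PC (ray x).
Proof.
by move=> x0; rewrite ray_simplex_cone; apply/in_PC_simplex_cone/row_free_rV.
Qed.

Lemma ray_self x : ray x x.
Proof. by exists 1 => //=; rewrite scale1r. Qed.

Lemma rayZ x (l : R) : 1 <= l -> ray x (l *: x).
Proof. by move=> l1; exists l. Qed.

Lemma ray_sub K x : in_PC K -> K x -> ray x `<=` K.
Proof. by move=> PK Kx _ [l l1 <-]; exact: in_PC_scale. Qed.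

Lemma ray_scale_sub x (l : R) : x != 0 -> 1 <= l -> ray (l *: x) `<=` ray x.
Proof. by move=> x0 l1; apply: ray_sub; [exact: in_PC_ray | exact: rayZ]. Qed.

Lemma rayZP x (l : R) : x != 0 -> ray x (l *: x) <-> 1 <= l.
Proof.
move=> x0; split; last exact: rayZ.
move=> [m m1 /eqP]; rewrite -subr_eq0 -scalerBl scaler_eq0 (negbTE x0) orbF.
by rewrite subr_eq0 => /eqP <-.
Qed.

Definition indep x y := forall a b : R, a *: x + b *: y = 0 -> a = 0 /\ b = 0.

Lemma indep_neq0l x y : indep x y -> x != 0.
Proof.
move=> xy; apply/eqP => x0; have [] := xy 1 0; last by lra.
by rewrite x0 scaler0 scale0r addr0.
Qed.

Lemma indep_neq0r x y : indep x y -> y != 0.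
Proof.
move=> xy; apply/eqP => x0; have [] := xy 0 1; last by lra.
by rewrite x0 scaler0 scale0r addr0.
Qed.

Lemma row_free_indep x y : indep x y -> row_free (col_mx x y).
Proof.
move=> xy; apply: inj_row_free => v; rewrite -[v]hsubmxK mul_row_col.
rewrite [lsubmx v]mx11_scalar [rsubmx v]mx11_scalar !mul_scalar_mx.
move=> /xy[-> ->].
by rewrite !raddf0 row_mx0.
Qed.

Lemma join_rayP x y v : indep x y -> join_set (ray x) (ray y) v <->
  exists a b : R, [/\ 0 <= a, 0 <= b, 1 <= a + b & v = a *: x + b *: y].
Proof.
move=> xy.
have Px := in_PC_ray (indep_neq0l xy).
have Py := in_PC_ray (indep_neq0r xy).
have -> : join_set (ray x) (ray y) = simplex_cone (col_mx x y).
  apply: join_eq => //.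
  - by apply: in_PC_simplex_cone; apply: row_free_indep.
  - move=> _ [l /= l1 <-]; apply/simplex_cone_col_mxP; exists l%:M, 0.
    rewrite scale0r addr0 mul_scalar_mx big_ord1 mxE mulr1n addr0; split => //.
    by move=> i; rewrite ord1 mxE mulr1n; lra.
  - move=> _ [l /= l1 <-]; apply/simplex_cone_col_mxP; exists 0, l.
    rewrite mul0mx add0r big_ord1 mxE add0r; split => //; last by lra.
    by move=> i; rewrite mxE.
  - move=> K PK xK yK v' /simplex_cone_col_mxP[a [b [a0 b0 ab ->]]].
    rewrite [a]mx11_scalar mul_scalar_mx; apply: in_PC_comb => //.
    + by apply: xK; exact: ray_self.
    + by apply: yK; exact: ray_self.
    + by move: ab; rewrite big_ord1.
split.
  move=> /simplex_cone_col_mxP[a [b [a0 b0 ab ->]]]; exists (a 0 0), b.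
  split => //; first by move: ab; rewrite big_ord1.
  by rewrite {1}[a]mx11_scalar mul_scalar_mx.
move=> [a [b [a0 b0 ab ->]]]; apply/simplex_cone_col_mxP; exists a%:M, b.
rewrite mul_scalar_mx big_ord1 mxE mulr1n; split => //.
by move=> i; rewrite ord1 mxE mulr1n.
Qed.

End Basics.

(** * Separation and duality *)

Section Duality.
Context {R : realType} {n : nat}.
Local Notation V := 'rV[R]_n.
Implicit Types (A B K : set V) (x y u v : V).

Lemma continuous_sqdist y : continuous (fun k : V => dot (k - y) (k - y) : R).
Proof.
rewrite [X in continuous X](_ : _ = fun k : V =>
    \sum_(i < n) (k 0 i - y 0 i) * (k 0 i - y 0 i)); last first.
  by apply/funext => k; apply: eq_bigr => i _; rewrite !mxE.
apply: (continuous_big (op := +%R)); first exact: add_continuous.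
move=> j _ v; have h : {for v, continuous (fun k : V => k 0 j - y 0 j)}.
  apply: (@continuousB _ _ _ (fun k : V => k 0 j) (fun=> y 0 j)).
  exact: coord_continuous.
  exact: cst_continuous.
exact: (continuousM h h).
Qed.

Lemma compact_dot_ball K y (r : R) : closed K ->
  compact (K `&` [set k : V | dot (k - y) (k - y) <= r]).
Proof.
move=> cK; pose I (i : 'I_n) := `[y 0 i - (r + 1), y 0 i + (r + 1)]%classic.
apply: (@subclosed_compact _ _ [set v : V | forall i, I i (v 0 i)]).
- apply: closedI => //.
  apply: (@closed_continuous_preimage _ _ (fun k => dot (k - y) (k - y))
    [set s | s <= r]); last exact: closed_le.
  exact: continuous_sqdist.
- by apply: rV_compact => i; exact: segment_compact.
- move=> k [_ /= kr] i; rewrite /I /= in_itv /=.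
  have h : (k 0 i - y 0 i) * (k 0 i - y 0 i) <= r.
    apply: le_trans kr; rewrite /dot (bigD1 i)//= !mxE lerDl.
    by apply: sumr_ge0 => j _; rewrite -expr2 sqr_ge0.
  pose d := k 0 i - y 0 i; have {}h : d * d <= r := h.
  have h1 : 0 <= (d - 1) * (d - 1) by rewrite -expr2 sqr_ge0.
  have h2 : 0 <= (d + 1) * (d + 1) by rewrite -expr2 sqr_ge0.
  have h3 : 0 <= d * d by rewrite -expr2 sqr_ge0.
  have h4 : d <= r + 1 by nra.
  have h5 : - (r + 1) <= d by nra.
  by move: h4 h5; rewrite /d => h4 h5; apply/andP; split; lra.
Qed.

(** The functional is [y - p], where [p] is a point of [K] nearest to [y]; it exists by compactness
    of bounded closed sets. *)
Lemma separation K y : convex_subset K -> closed K -> K !=set0 -> ~ K y ->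
  exists f c, (forall k, K k -> dot f k <= c) /\ c < dot f y.
Proof.
move=> cvxK cK [k0 Kk0] Ky.
pose q (k : V) := dot (k - y) (k - y).
pose A := K `&` [set k : V | q k <= q k0].
have [||p /set_mem[Kp qp] pmin] :=
    @compact_EVT_min _ _ q A _ (compact_dot_ball (y := y) (r := q k0) cK).
- by exists k0; split => /=.
- apply: continuous_subspaceT; exact: continuous_sqdist.
have {}pmin k : K k -> q p <= q k.
  move=> Kk; have [qk|qk] := leP (q k) (q k0); last exact: le_trans (ltW qk).
  by apply: pmin; apply/mem_set.
exists (y - p), (dot (y - p) p); split; last first.
  rewrite -subr_gt0 -dotNr -dotDr dot_gt0// subr_eq0.
  by apply: contra_notN Ky => /eqP ->.
move=> k Kk; rewrite -subr_le0 -dotNr -dotDr leNgt; apply/negP => h.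
set a := dot _ _ in h; pose b := dot (k - p) (k - p).
have b0 : 0 <= b by exact: dot_ge0.
(* This makes [t <= 1] and [t * b < 2 * a], so moving from [p] towards [k] by [t] would strictly
   decrease the distance to [y]. *)
pose t := a / (a + b); have ab0 : 0 < a + b by lra.
have t0 : 0 < t by rewrite divr_gt0.
have t1 : t <= 1 by rewrite ler_pdivrMr// mul1r lerDl.
have tab : t * (a + b) = a by rewrite divfK// gt_eqF.
have /pmin : K (t *: k + (1 - t) *: p).
  by move/convex_subsetP: cvxK; apply => //; rewrite ltW.
have -> : t *: k + (1 - t) *: p = p + t *: (k - p).
  by rewrite scalerBr scalerBl scale1r addrC -addrA (addrC (- _)).
have -> : q (p + t *: (k - p)) = q p - 2 * t * a + t * t * b.
  rewrite /q addrAC -(opprB y p) /a /b.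
  move: (y - p) (k - p) => e w.
  by rewrite dotDl !dotDr !dotZr !dotZl !dotNl !dotNr (dotC w e); ring.
nra.
Qed.

Lemma dual_sub A B : A `<=` B -> dual_set B `<=` dual_set A.
Proof. by move=> AB x Bx y Ay; apply/Bx/AB. Qed.

Lemma sub_bidual A : A `<=` dual_set (dual_set A).
Proof. by move=> x Ax y; rewrite dotC; exact. Qed.

Lemma in_PC_dual K : in_PC K -> in_PC (dual_set K).
Proof.
move=> PK; have [->|/eqP/set0P[k Kk]] := pselect (K = set0).
  by rewrite dual_set_set0; exact: in_PCT.
have [->|/eqP/set0P D0] := pselect (dual_set K = set0); first exact: in_PC0.
apply: Or31; split; last first.
  rewrite /dual_set; apply: closed_forall => y; apply: closed_forall => _.
  exact: closed_dot_le.
split=> //.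
- apply/convex_subsetP => x y t Dx Dy /andP[t0 t1] z Kz.
  rewrite dotDl !dotZl; have := Dx _ Kz; have := Dy _ Kz; nra.
- by move=> /(_ _ Kk); rewrite dot0l; lra.
- by move=> x l Dx l1 y Ky; rewrite dotZl; have := Dx _ Ky; nra.
Qed.

(** Bipolar theorem. For [y] outside [K], [f] separates [y] from [K] and [h] separates the origin
    from [K]; a multiple of [f], or a combination of [f] and [h], then lies in the dual and excludes
    [y]. *)
Lemma in_PC_bidual K : in_PC K -> dual_set (dual_set K) = K.
Proof.
move=> PK; apply/seteqP; split; last exact: sub_bidual.
move=> y DDy; apply: contrapT => Ky.
case: (PK) => [[[K0 cK K0' sK] clK]|E|E].
- have [f [c [fK cy]]] := separation cK clK K0 Ky.
  have [h [d [hK d0]]] := separation cK clK K0 K0'.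
  rewrite dot0r in d0.
  (* A positive value would grow beyond [c] along the ray of [k]. *)
  have fK0 k : K k -> dot f k <= 0.
    move=> Kk; rewrite leNgt; apply/negP => fk0.
    pose l := 1 + `|c| / dot f k.
    have l1 : 1 <= l by rewrite lerDl divr_ge0// ltW.
    have := fK _ (sK _ _ Kk l1); rewrite dotZr /l mulrDl divfK ?gt_eqF//.
    by have := ler_norm c; lra.
  have [c0|c0] := ltP c 0.
    have /DDy : dual_set K ((- c)^-1 *: f).
      move=> k Kk; rewrite dotZl mulrC ler_pdivrMr ?oppr_gt0// mulrNN mul1r.
      exact: fK.
    rewrite dotZr mulrC ler_pdivrMr ?oppr_gt0// mulrNN mul1r dotC.
    by lra.
  have fy0 : 0 < dot f y by lra.
  (* The term in [f] outweighs the one in [h] at [y], while on [K] it is nonpositive and leaves the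
     bound [-1] given by [h] intact. *)
  pose M := (`|dot h y / - d| + 1) / dot f y.
  have M0 : 0 <= M by rewrite divr_ge0 ?(ltW fy0)// addr_ge0.
  have /DDy : dual_set K (M *: f + (- d)^-1 *: h).
    move=> k Kk; rewrite dotDl !dotZl.
    have h1 : (- d)^-1 * dot h k <= -1.
      by rewrite mulrC ler_pdivrMr ?oppr_gt0// mulrNN mul1r; exact: hK.
    by have := fK0 _ Kk; nra.
  rewrite dotDr !dotZr /M !(dotC y) divfK ?gt_eqF//.
  rewrite (mulrC (- d)^-1); have := ler_norm (- (dot h y / - d)).
  by rewrite normrN; lra.
- by move: DDy; rewrite E dual_set_set0 dual_set_setT.
- by apply: Ky; rewrite E.
Qed.

Lemma dual_set_join A B : in_PC A -> in_PC B ->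
  dual_set (join_set A B) = dual_set A `&` dual_set B.
Proof.
move=> PA PB; apply/seteqP; split.
  move=> x h; split; apply: dual_sub h; first exact: join_subl.
  exact: join_subr.
have PD : in_PC (dual_set A `&` dual_set B).
  by apply: in_PCI; exact: in_PC_dual.
rewrite -{1}(in_PC_bidual PD); apply: dual_sub.
apply: join_sub (in_PC_dual PD) _ _ => x h y [yA yB]; rewrite dotC.
  exact: yA.
exact: yB.
Qed.

Lemma dual_set_meet A B : in_PC A -> in_PC B ->
  dual_set (A `&` B) = join_set (dual_set A) (dual_set B).
Proof.
move=> PA PB; have PA' := in_PC_dual PA; have PB' := in_PC_dual PB.
rewrite -{1}(in_PC_bidual PA) -{1}(in_PC_bidual PB) -dual_set_join//.
by rewrite in_PC_bidual//; exact: in_PC_join.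
Qed.

Lemma dual_rayP u y : dual_set (ray u) y <-> dot y u <= -1.
Proof.
split=> [h|h _ [l /= l1 <-]]; first by apply: h; exact: ray_self.
by rewrite dotZr; nra.
Qed.

End Duality.

(** * Countability arguments *)

Section Countability.
Context {R : realType}.

Lemma countableU T (A B : set T) :
  countable A -> countable B -> countable (A `|` B).
Proof.
move=> cA cB; rewrite (_ : A `|` B =
    \bigcup_(b in [set: bool]) (if b then A else B)).
  by apply: bigcup_countable => [|[] _//]; exact: countableP.
apply/seteqP; split=> [x [Ax|Bx]|x [[] _ ?]].
- by exists true.
- by exists false.
- by left.
- by right.
Qed.

(** Such an [f] would make the reals countable, whereas the unit interval has Lebesgue measure
    one. *)
Lemma uncountable_reals (A : set R) (T : countType) (f : R -> T) :
  countable A -> {in ~` A &, injective f} -> False.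
Proof.
move=> cA fi; have cC : countable (~` A).
  apply/countable_injP; exists (pickle \o f) => x y Ax Ay /(pcan_inj pickleK).
  exact: fi.
have c : countable [set: R] by rewrite -(setUv A) countableU.
have := countable_lebesgue_measure0
  (sub_countable (subset_card_le (@subsetT _ `[0%R, 1%R]%classic)) c).
rewrite lebesgue_measure_itv /= lte_fin ltr01 -EFinB subr0 => /eqP.
by rewrite onee_eq0.
Qed.

Lemma rat_rV_above m (p : 'rV[R]_m) (e : R) : 0 < e ->
  exists q : 'rV[rat]_m, forall i, p 0 i < ratr (q 0 i) < p 0 i + e.
Proof.
move=> e0; have [i|f hf] := @choice _ _
    (fun i (q : rat) => p 0 i < ratr q < p 0 i + e).
  by apply: rat_in_itvoo; rewrite ltrDl.
by exists (\row_i f i) => i; rewrite mxE.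
Qed.

Lemma closed_avoid_ball m (C : set 'rV[R]_m) p : closed C -> ~ C p ->
  exists2 e : R, 0 < e &
    forall z : 'rV[R]_m, (forall i, `|p 0 i - z 0 i| < e) -> ~ C z.
Proof.
move=> cC Cp; have : nbhs p (~` C).
  by apply: open_nbhs_nbhs; split => //; exact: closed_openC.
move=> /nbhs_ballP[e /= e0 h]; exists e => // z hz; apply: h; split => // i j.
by rewrite ord1; exact: hz.
Qed.

(* The rational boxes separating [p a] from [C a] are pairwise distinct. *)
Lemma no_real_chain m (C : R -> set 'rV[R]_m) (p : R -> 'rV[R]_m) :
  (forall a, closed (C a)) -> (forall a, ~ C a (p a)) ->
  (forall a b, a < b -> C a (p b)) -> False.
Proof.
move=> cC Cp Cp'.
have [a|code hcode] := @choice _ _ (fun a (qr : 'rV[rat]_m * rat) =>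
    (forall i, `|p a 0 i - ratr (qr.1 0 i)| < ratr qr.2) /\
    forall z : 'rV[R]_m, (forall i, `|z 0 i - ratr (qr.1 0 i)| < ratr qr.2) ->
      ~ C a z).
  have [e e0 he] := closed_avoid_ball (cC a) (Cp a).
  have [r] : exists r : rat, ratr r \in `]0, (e / 2)[.
    by apply: rat_in_itvoo; rewrite divr_gt0.
  rewrite in_itv/= => /andP[r0 re]; have [q hq] := rat_rV_above (p a) r0.
  exists (q, r); split=> /= [i|z hz].
    by have /andP[? ?] := hq i; rewrite ltr_norml; apply/andP; split; lra.
  apply: he => i; have /andP[? ?] := hq i.
  by have := hz i; rewrite !ltr_norml => /andP[? ?]; apply/andP; split; lra.
apply: (@uncountable_reals set0 _ code) => // a b _ _.
wlog ab : a b / a <= b => [hw|].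
  by have [/hw//|/ltW/hw h /esym/h] := leP a b.
move: ab; rewrite le_eqVlt => /orP[/eqP//|ab] E.
by have [] := (hcode a).2 (p b) _ (Cp' _ _ ab); rewrite E; exact: (hcode b).1.
Qed.

End Countability.

(** * Rays and dual bases *)

Section Rays.
Context {R : realType} {n : nat}.
Local Notation V := 'rV[R]_n.
Implicit Types (A B K : set V) (x y u v : V).

(** Bernoulli's inequality [1 + k a <= (1 + a)^k] combined with the archimedean property. *)
Lemma bernoulli_lt (a c : R) : 0 < a -> exists k : nat, c < (1 + a) ^+ k.
Proof.
move=> a0; exists (Num.bound (`|c| / a)); set k := Num.bound _.
have h : `|c| / a < k%:R by apply: archi_boundP; rewrite divr_ge0// ltW.
apply: (@lt_le_trans _ _ (k%:R * a)).
  by rewrite ltr_pdivrMr// in h; apply: le_lt_trans (ler_norm _) h.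
have : 1 + k%:R * a <= (1 + a) ^+ k; last by apply: le_trans; rewrite lerDr.
elim: k {h} => [|k IH]; first by rewrite mul0r addr0 expr0.
rewrite exprS -natr1; apply: le_trans (ler_wpM2l _ IH); last by lra.
have : 0 <= k%:R * a * a by rewrite !mulr_ge0// ltW.
by nra.
Qed.

Lemma ray_disjoint x y : (forall c, 0 < c -> y != c *: x) ->
  ray x `&` ray y = set0.
Proof.
move=> h; apply/seteqP; split=> // _ [[l /= l1 <-] [m /= m1 e]].
have m0 : m != 0 by apply/eqP => m0; lra.
have := h (l / m); rewrite divr_gt0; [|lra..].
move=> /(_ isT)/eqP; apply; rewrite mulrC -scalerA -e scalerA mulVf//.
by rewrite scale1r.
Qed.

Lemma join_ray_opp x : x != 0 -> join_set (ray x) (ray (- x)) = setT.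
Proof.
move=> x0; have x0' : - x != 0 by rewrite oppr_eq0.
have PJ := in_PC_join (in_PC_ray x0) (in_PC_ray x0').
apply: in_PC_has0 => //; have /convex_subsetP cJ := in_PC_convex PJ.
rewrite (_ : 0 = 2^-1 *: x + (1 - 2^-1) *: - x).
  apply: cJ; [exact/join_subl/ray_self | exact/join_subr/ray_self | lra].
by rewrite scalerN -scalerBl (_ : 2^-1 - _ = 0) ?scale0r//; lra.
Qed.

Lemma row_free_dual k (X : 'M[R]_(k, n)) : row_free X ->
  exists Y : 'M[R]_(k, n), forall i j, dot (row i X) (row j Y) = (i == j)%:R.
Proof.
move=> /row_freeP[Y XY]; exists Y^T => i j.
rewrite dot_mulmx tr_row trmxK.
move/matrixP/(_ i j): XY; rewrite !mxE => <-.
by apply: eq_bigr => l _; rewrite !mxE.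
Qed.

Lemma dual_pair x y : indep x y -> exists xi om : V,
  [/\ dot xi x = 1, dot xi y = 0, dot om x = 0 & dot om y = 1].
Proof.
move=> xy; have [Y XY] := row_free_dual (row_free_indep xy).
have ex : x = row (lshift 1 ord0) (col_mx x y) by rewrite rowKu row_id.
have ey : y = row (rshift 1 ord0) (col_mx x y) by rewrite rowKd row_id.
exists (row (lshift 1 ord0) Y), (row (rshift 1 ord0) Y).
split; rewrite dotC.
- by rewrite {1}ex XY eqxx.
- by rewrite {1}ey XY.
- by rewrite {1}ex XY.
- by rewrite {1}ey XY eqxx.
Qed.

Lemma exists_neq_ord (i : 'I_n) : (2 <= n)%N -> exists j : 'I_n, j != i.
Proof.
move=> n2; pose a : 'I_n := Ordinal (ltnW n2); pose b := Ordinal n2.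
have [ai|ai] := eqVneq a i; last by exists a.
by exists b; rewrite -ai.
Qed.

Lemma exists_indep x : (2 <= n)%N -> x != 0 -> exists y, indep x y.
Proof.
move=> n2 /rV0Pn[i xi]; have [j ji] := exists_neq_ord i n2.
exists (delta_mx 0 j) => a b e; have a0 : a = 0.
  move/rowP/(_ i): e; rewrite !mxE eqxx/= eq_sym (negbTE ji) mulr0 addr0.
  by move/eqP; rewrite mulf_eq0 (negbTE xi) orbF => /eqP.
split=> //; move/rowP/(_ j): e.
by rewrite !mxE !eqxx a0 mul0r add0r mulr1.
Qed.

End Rays.

(** * Lattice endomorphisms *)

Section LatticeEndomorphism.
Context {R : realType} {n : nat}.
Local Notation V := 'rV[R]_n.
Implicit Types (A B K : set V) (x y u v : V).

(** The map acts on bare sets, so that membership proofs need not be carried along; only its values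
    on [in_PC] sets are constrained. *)
Definition PC_endo (s : set V -> set V) := forall A B, in_PC A -> in_PC B ->
  [/\ in_PC (s A), s (A `&` B) = s A `&` s B &
      s (join_set A B) = join_set (s A) (s B)].

(** Conjugation by duality transfers every result on rays to half-spaces. *)
Lemma PC_endo_dual s : PC_endo s ->
  PC_endo (fun K => dual_set (s (dual_set K))).
Proof.
move=> hs A B PA PB; have PA' := in_PC_dual PA; have PB' := in_PC_dual PB.
have [sA sI sJ] := hs _ _ PA' PB'; have [sB _ _] := hs _ _ PB' PA'.
split; first exact: in_PC_dual.
  by rewrite dual_set_meet// sJ dual_set_join.
by rewrite dual_set_join// sI dual_set_meet.
Qed.

Context (s : set V -> set V) (hs : PC_endo s).

Lemma endo_in_PC A : in_PC A -> in_PC (s A).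
Proof. by move=> PA; case: (hs PA PA). Qed.

Lemma endoI A B : in_PC A -> in_PC B -> s (A `&` B) = s A `&` s B.
Proof. by move=> PA PB; case: (hs PA PB). Qed.

Lemma endoJ A B : in_PC A -> in_PC B ->
  s (join_set A B) = join_set (s A) (s B).
Proof. by move=> PA PB; case: (hs PA PB). Qed.

Lemma endo_sub A B : in_PC A -> in_PC B -> A `<=` B -> s A `<=` s B.
Proof. by move=> PA PB /setIidPl <-; rewrite endoI//; exact: subIsetr. Qed.

Context (n2 : (2 <= n)%N) (nonconst : s set0 <> s setT).

(** Otherwise joining with the opposite ray gives [s setT = s (ray (- x))], so every ray disjoint
    from [ray (- x)] has image [s set0]. Two opposite such rays join to the whole space, which
    contradicts [nonconst]. *)
Lemma endo_ray_neq0 x : x != 0 -> s (ray x) <> s set0.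
Proof.
move=> x0 E; have x0' : - x != 0 by rewrite oppr_eq0.
have Px := in_PC_ray x0; have Px' := in_PC_ray x0'.
have sub0 K : in_PC K -> s set0 `<=` s K.
  by move=> PK; apply: endo_sub => //; exact: in_PC0.
have jK K : in_PC K -> join_set (s set0) (s K) = s K.
  move=> PK; apply: join_eq => //; [exact/endo_in_PC/in_PC0 |
    exact: endo_in_PC.. | exact: sub0].
have ET : s setT = s (ray (- x)) by rewrite -(join_ray_opp x0) endoJ// E jK.
have triv y : y != 0 -> (forall c, 0 < c -> y != c *: - x) ->
    s (ray y) = s set0.
  move=> y0 hy; rewrite -(ray_disjoint hy) endoI//; last exact: in_PC_ray.
  rewrite -ET; apply/esym/setIidPr; apply: endo_sub => //; last exact: in_PCT.
  exact: in_PC_ray.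
have [y xy] := exists_indep n2 x0; have y0 := indep_neq0r xy.
have y0' : - y != 0 by rewrite oppr_eq0.
have t1 : s (ray y) = s set0.
  apply: triv => // c c0; apply/eqP => e; have [] := xy c 1; last by lra.
  by rewrite e scale1r scalerN subrr.
have t2 : s (ray (- y)) = s set0.
  apply: triv => // c c0; apply/eqP; rewrite scalerN => /oppr_inj e.
  have [] := xy c (-1); last by lra.
  by rewrite scaleN1r e subrr.
apply: nonconst; rewrite -(join_ray_opp y0) endoJ; [|exact: in_PC_ray..].
by rewrite t1 t2 jK//; exact: in_PC0.
Qed.

Lemma indepZl x y (c : R) : c != 0 -> indep x y -> indep (c *: x) y.
Proof.
move=> c0 xy a b; rewrite scalerA => /xy[/eqP].
by rewrite mulf_eq0 (negbTE c0) orbF => /eqP.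
Qed.

(* If [s] identifies [ray x] with [ray (l *: x)], then joining both with the
   ray of [2 c w - x] identifies two proper sub-rays of the ray of [w]. *)
Lemma endo_ray_collapse_step x w (l : R) : indep x w -> 1 < l ->
  s (ray (l *: x)) = s (ray x) ->
  forall c, 0 < c -> s (ray (c *: w)) = s (ray ((2 * l / (l + 1)) *: (c *: w))).
Proof.
move=> xw l1 E c c0; set k := 2 * l / (l + 1).
have l10 : 0 < l + 1 by lra.
have k1 : 1 <= k by rewrite /k ler_pdivlMr// mul1r; lra.
pose y : V := - x + (2 * c) *: w.
have xy : indep x y.
  move=> a b; rewrite /y scalerDr scalerN scalerA addrA -scalerBl => /xw[e1 e2].
  have b0 : b = 0.
    by move/eqP: e2; rewrite mulf_eq0 => /orP[/eqP//|]; rewrite gt_eqF//; lra.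
  by rewrite b0 subr0 in e1.
have lxy : indep (l *: x) y by apply: indepZl => //; rewrite gt_eqF//; lra.
have x0 := indep_neq0l xy; have y0 := indep_neq0r xy.
have lx0 := indep_neq0l lxy; have w0 := indep_neq0r xw.
have cw0 : c *: w != 0 by rewrite scaler_eq0 negb_or w0 gt_eqF.
have kcw0 : k *: (c *: w) != 0 by rewrite scaler_eq0 negb_or cw0 gt_eqF//; lra.
have Px := in_PC_ray x0; have Py := in_PC_ray y0; have Plx := in_PC_ray lx0.
have Pcw := in_PC_ray cw0; have Pkcw := in_PC_ray kcw0.
have D1 : ray (c *: w) `&` join_set (ray x) (ray y) = ray (c *: w).
  apply/setIidPl/(ray_sub (in_PC_join Px Py)).
  apply: (join_rayP _ xy).2; exists 2^-1, 2^-1; split; [lra..|].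
  rewrite /y scalerDr scalerA scalerN addrA subrr add0r.
  by rewrite mulrA mulVf ?mul1r// gt_eqF//; lra.
(* A point [a (l x) + b y] on the line of [w] has [b = a l] and equals [2 b c w]; the condition
   [a + b >= 1] then reads [2 b >= k]. *)
have D2 : ray (c *: w) `&` join_set (ray (l *: x)) (ray y) =
    ray (k *: (c *: w)).
  apply/seteqP; split.
    move=> _ [[m /= m1 <-]] /(join_rayP _ lxy)[a [b [a0 b0 ab]]].
    move=> /eqP; rewrite -subr_eq0 => /eqP.
    rewrite /y scalerDr scalerN !scalerA => e.
    have [] := xw (b - a * l) (m * c - b * (2 * c)).
      by apply/rowP => i; move/rowP/(_ i): e; rewrite !mxE => <-; ring.
    move=> /eqP; rewrite subr_eq0 => /eqP b_eq.
    move=> /eqP; rewrite subr_eq0 mulrA => /eqP.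
    move/(mulIf (lt0r_neq0 c0)) => m_eq.
    have km : k <= m.
      by rewrite /k ler_pdivrMr// m_eq b_eq; nra.
    exists (m / k); first by rewrite /= ler_pdivlMr ?mul1r//; lra.
    by rewrite !scalerA mulrA divfK ?gt_eqF//; lra.
  move=> z [m /= m1 <-]; split.
    by rewrite scalerA; apply: rayZ; nra.
  apply: in_PC_scale => //; first exact: in_PC_join Plx Py.
  apply: (join_rayP _ lxy).2; exists (k / 2 / l), (k / 2).
  have l0 : 0 < l by lra.
  split; [by rewrite !divr_ge0//; lra | lra | |].
    rewrite -(@ler_pM2r _ l)// mulrDl divfK ?gt_eqF// /k.
    rewrite -(@ler_pM2r _ (l + 1))// mulrDl mulrAC.
    have -> : 2 * l / (l + 1) / 2 * (l + 1) = l by field; rewrite gt_eqF.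
    have -> : 2 * l / (l + 1) / 2 * l * (l + 1) = l * l.
      by field; rewrite gt_eqF.
    lra.
  rewrite /y scalerDr !scalerA divfK ?gt_eqF// scalerN addrA subrr add0r.
  by congr (_ *: _); field.
by rewrite -{1}D1 -D2 !endoI// ?endoJ ?E//; exact: in_PC_join.
Qed.

(** Iterating the previous step identifies [ray w] with [ray (k ^+ j *: w)] for all [j]; since
    [k > 1], these powers pass [m], and monotonicity squeezes the image of [ray (m *: w)]. *)
Lemma endo_ray_collapse x w (l : R) : indep x w -> 1 < l ->
  s (ray (l *: x)) = s (ray x) ->
  forall m, 1 <= m -> s (ray (m *: w)) = s (ray w).
Proof.
move=> xw l1 E m m1; have step := endo_ray_collapse_step xw l1 E.
set k := _ / _ in step; have l10 : 0 < l + 1 by lra.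
have k1 : 1 < k by rewrite /k ltr_pdivlMr// mul1r; lra.
have w0 := indep_neq0r xw.
have pow j : s (ray (k ^+ j *: w)) = s (ray w).
  elim: j => [|j IH]; first by rewrite expr0 scale1r.
  by rewrite exprS -scalerA -step// exprn_gt0//; lra.
have [j mj] : exists j, m < k ^+ j.
  by rewrite -[k](subrK 1) addrC; apply: bernoulli_lt; lra.
have mw0 : m *: w != 0 by rewrite scaler_eq0 negb_or w0 gt_eqF//; lra.
have kw0 : k ^+ j *: w != 0.
  by rewrite scaler_eq0 negb_or w0 gt_eqF// exprn_gt0//; lra.
apply/seteqP; split.
  by apply: endo_sub; [exact: in_PC_ray.. | exact: ray_scale_sub].
rewrite -(pow j); apply: endo_sub; [exact: in_PC_ray.. |].
have -> : k ^+ j *: w = (k ^+ j / m) *: (m *: w).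
  by rewrite scalerA divfK// gt_eqF//; lra.
by apply: ray_scale_sub => //; rewrite ler_pdivlMr ?mul1r; lra.
Qed.

(** Since [<u a, y b> = a - b], the ray of [y a] misses the half-space of [u a], whereas for [a < b]
    the ray of [y b] eventually enters it. If lengths are invisible to [s], the images of these
    half-spaces contradict [no_real_chain]. *)
Lemma endo_ray_scale_neq x (l : R) : x != 0 -> 1 < l ->
  s (ray (l *: x)) <> s (ray x).
Proof.
move=> x0 l1 E; have [w xw] := exists_indep n2 x0.
have [xi [om [xix xiw omx omw]]] := dual_pair xw.
pose y a : V := w + a *: x; pose u a : V := a *: om - xi.
have uy a b : dot (u a) (y b) = a - b.
  rewrite /u /y dotDl !dotDr !dotNl !dotZl !dotZr xix xiw omx omw; ring.
have u0 a : u a != 0.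
  apply/eqP => ua; have : dot (u a) x = -1.
    by rewrite /u dotDl dotNl dotZl xix omx mulr0 add0r.
  by rewrite ua dot0l; lra.
have xy a : indep x (y a).
  move=> b c; rewrite /y scalerDr scalerA addrCA -scalerDl addrC => /xw[h1 h2].
  by move: h1; rewrite h2 mul0r addr0.
have y0 a : y a != 0 by exact: indep_neq0r (xy a).
have Pu a : in_PC (dual_set (ray (u a))) by apply/in_PC_dual/in_PC_ray.
have Py a : in_PC (ray (y a)) by exact: in_PC_ray.
have [a|p hp] := @choice _ _ (fun a (v : V) => s (ray (y a)) v /\ ~ s set0 v).
  apply: contrapT => h; apply: (endo_ray_neq0 (y0 a)); apply/seteqP; split.
    by move=> v sv; apply: contrapT => v0; apply: h; exists v.
  by apply: endo_sub => //; exact: in_PC0.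
apply: (@no_real_chain _ _ (fun a => s (dual_set (ray (u a)))) p) => a.
- by apply: in_PC_closed; exact: endo_in_PC.
- move=> sp; apply: (hp a).2.
  have -> : set0 = dual_set (ray (u a)) `&` ray (y a).
    apply/seteqP; split=> // z [+ [m /= m1 e]]; rewrite -e => /dual_rayP.
    by rewrite dotZl dotC uy subrr mulr0; lra.
  by rewrite endoI//; split => //; exact: (hp a).1.
(* With this factor [<u a, m y b> = -(b - a) - 1], which is below [-1]. *)
- move=> b ab; have [+ _] := hp b; pose m := 1 + (b - a)^-1.
  have ab0 : 0 < b - a by rewrite subr_gt0.
  have m1 : 1 <= m by rewrite lerDl invr_ge0 ltW.
  rewrite -(endo_ray_collapse (xy b) l1 E m1); apply: endo_sub => //.
    by apply: in_PC_ray; rewrite scaler_eq0 negb_or y0 gt_eqF//; lra.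
  apply: ray_sub => //; apply/dual_rayP; rewrite dotZl dotC uy /m mulrDl.
  by rewrite -(opprB b a) mulrN mulrN mulVf ?gt_eqF//; lra.
Qed.


End LatticeEndomorphism.

(** * Linear rank of the images *)

Section Rank.
Context {R : realType} {n : nat}.
Local Notation V := 'rV[R]_n.
Implicit Types (A B K T : set V) (x y u v p : V).

Definition rank_ge K m := exists2 X : 'M[R]_(m, n),
  row_free X & forall i, K (row i X).

Lemma rank_ge_le K m : rank_ge K m -> (m <= n)%N.
Proof. by move=> [X /eqP fX _]; have := rank_leq_col X; rewrite fX. Qed.

Lemma row_free_col_mx k (X : 'M[R]_(k, n)) v :
  row_free X -> ~~ (v <= X)%MS -> row_free (col_mx X v).
Proof.
move=> fX vX; apply: inj_row_free => w; rewrite -[w]hsubmxK mul_row_col.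
rewrite [rsubmx w]mx11_scalar mul_scalar_mx => /eqP e.
have b0 : rsubmx w 0 0 = 0.
  apply: contra_notP (negP vX) => /eqP b0; apply/submxP.
  exists (- (rsubmx w 0 0)^-1 *: lsubmx w); rewrite -scalemxAl.
  move: e; rewrite addr_eq0 => /eqP ->.
  by rewrite scaleNr scalerN opprK scalerA mulVf// scale1r.
move: e; rewrite b0 scale0r addr0 mulmx_free_eq0// => /eqP ->.
by rewrite raddf0 row_mx0.
Qed.

Lemma rank_ge_ext K k (X : 'M[R]_(k, n)) v : row_free X ->
  (forall i, K (row i X)) -> K v -> ~~ (v <= X)%MS -> rank_ge K k.+1.
Proof.
move=> fX KX Kv vX; rewrite -addn1; exists (col_mx X v).
  exact: row_free_col_mx.
by move=> i; case: (split_ordP i) => j ->; rewrite ?rowKu ?rowKd// ord1 row_id.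
Qed.

Lemma exists_row_free_col_mx k (X : 'M[R]_(k, n)) :
  row_free X -> (k < n)%N -> exists v : V, row_free (col_mx X v).
Proof.
move=> fX kn; suff [i hi] : exists i, ~~ ((delta_mx 0 i : 'rV[R]_n) <= X)%MS.
  by exists (delta_mx 0 i); exact: row_free_col_mx.
apply: contrapT => h; have : row_full X.
  rewrite -sub1mx; apply/row_subP => i; rewrite row1.
  by apply: contrapT => /negP hi; apply: h; exists i.
by rewrite /row_full (eqP fX) ltn_eqF.
Qed.

Lemma continuous_mulmx k (X : 'M[R]_(k, n)) :
  continuous (fun a : 'rV[R]_k => a *m X).
Proof.
rewrite [X in continuous X](_ : _ =
    fun a : 'rV[R]_k => \sum_i a 0 i *: row i X); last first.
  by apply/funext => a; rewrite mulmx_sum_row.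
elim: (index_enum _) => [|i r IH] a.
  under eq_fun do rewrite big_nil; exact: cst_continuous.
under eq_fun do rewrite big_cons.
apply: (@cvgD R V _ (nbhs a)); last exact: IH.
apply: (@cvgZ R V _ (nbhs a)); last exact: cvg_cst.
exact: coord_continuous.
Qed.

(* The rows of [X] are recession directions of [K], so [K] contains the open
   box spanned by them at [p]; it meets the rational points of the frame [Y]. *)
Lemma exists_rat_point m (Y : 'M[R]_(m, n)) (M : 'M[R]_m) K T (c : 'rV[R]_m) :
  M \in unitmx -> in_PC K -> (forall i, K (row i (M *m Y))) -> K (c *m Y) ->
  closed T -> ~ T (c *m Y) ->
  exists q : 'rV[rat]_m,
    K (map_mx ratr q *m Y) /\ ~ T (map_mx ratr q *m Y).
Proof.
move=> uM PK KX Kp cT Tp.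
pose g (a : 'rV[R]_m) : V := c *m Y + a *m (M *m Y).
have [e e0 he] : exists2 e : R, 0 < e &
    forall a : 'rV[R]_m, (forall i, `|a 0 i| < e) -> ~ T (g a).
  have cg : continuous g.
    move=> a; apply: (@cvgD R V _ (nbhs a)); first exact: cvg_cst.
    exact: continuous_mulmx.
  have [||e e0 h] := @closed_avoid_ball R m (g @^-1` T) 0.
  - by apply: preimage_closed => // a _; exact: cg.
  - by rewrite /g /= mul0mx addr0.
  exists e => // a ha; apply: h => i; rewrite mxE add0r normrN.
  exact: ha.
(* In coordinates with respect to [Y] the box consists of the [c + a *m M] with all [a_i] in []0,
   e[]; [d0] is its centre. *)
pose l i := (c *m invmx M) 0 i; pose d0 := c + const_mx (e / 2) *m M.
pose O i := [set d : 'rV[R]_m | (d *m invmx M) 0 i \in `](l i), (l i + e)[].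
have : nbhs d0 [set d | forall i, O i d].
  suff h i : nbhs d0 (O i) by exact: (filter_forall (nbhs_filter d0) h).
  have d0i : (d0 *m invmx M) 0 i \in `](l i), (l i + e)[.
    rewrite /d0 mulmxDl mulmxK// mxE [X in _ + X]mxE in_itv/= -/(l i).
    by apply/andP; split; lra.
  exact: (@continuous_mulmx_coord R m m (invmx M) i d0 _ (near_in_itvoo d0i)).
move=> /nbhs_ballP[r /= r0 hr]; have [q hq] := rat_rV_above d0 r0.
have {}hr : forall i, (map_mx ratr q *m invmx M) 0 i \in `](l i), (l i + e)[.
  apply: hr; split => // i j; rewrite ord1 /ball /= [X in _ - X]mxE.
  by have /andP[? ?] := hq j; rewrite ltr_norml; apply/andP; split; lra.
pose a := map_mx ratr q *m invmx M - c *m invmx M.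
have ha i : 0 < a 0 i < e.
  have := hr i; rewrite in_itv/= => /andP[h1 h2].
  by rewrite /a mxE [X in _ + X]mxE -/(l i); apply/andP; split; lra.
have ga : map_mx ratr q *m Y = g a.
  by rewrite /g /a -mulmxBl mulmxA mulmxKV// mulmxBl addrC subrK.
exists q; rewrite ga; split; last first.
  by apply: he => i; have /andP[? ?] := ha i; rewrite gtr0_norm.
rewrite /g [X in _ + X]mulmx_sum_row.
apply: (@in_PC_add_sum _ _ K _ _ _ (a 0) (fun i => row i (M *m Y))) => // i.
by have /andP[/ltW] := ha i.
Qed.

(** Each code belongs to at most one parameter, so choosing codes injects [D] into a countable
    type. *)
Lemma countable_code (D : set R) (C : countType) (P : R -> C -> Prop) :
  (forall a, D a -> exists q, P a q) ->
  (forall a b q, P a q -> P b q -> a = b) -> countable D.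
Proof.
move=> DP Pinj; have [->|/eqP/set0P[a0 Da0]] := pselect (D = set0).
  exact: countable0.
have [q0 _] := DP _ Da0.
have [a|f hf] := @choice _ _ (fun a q => D a -> P a q).
  have [/DP[q Pq]|nD] := pselect (D a); first by exists q.
  by exists q0.
apply/countable_injP; exists (pickle \o f) => a b /set_mem Da /set_mem Db.
move=> /= /(pcan_inj pickleK) e; apply: (Pinj _ _ (f a)); first exact: hf.
by rewrite e; exact: hf.
Qed.

(* Rational points of [F a \ T] taken in a fixed frame are pairwise distinct,
   the frame being that of [T] when [F a] lies in the span of [T], and the
   standard one when [F a] spans the whole space. *)
Lemma countable_rank_exceptions T (F : R -> set V) m :
  in_PC T -> (forall a, in_PC (F a)) -> (forall a, T `<=` F a) ->
  (forall a, F a <> T) -> (forall a b, a <> b -> F a `&` F b `<=` T) ->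
  rank_ge T m ->
  countable [set a | ~ rank_ge (F a) m.+1 \/ rank_ge (F a) n].
Proof.
move=> PT PF TF FT FF [X fX TX].
have newpt a : exists2 p, F a p & ~ T p.
  apply: contrapT => h; apply: (FT a); apply/seteqP; split => // p Fp.
  by apply: contrapT => Tp; apply: h; exists p.
have cT := in_PC_closed PT.
(* A point outside [T] lies in at most one [F a], so its rational coordinates determine [a]. *)
have inj k (Y : 'M[R]_(k, n)) a b (q : 'rV[rat]_k) :
    F a (map_mx ratr q *m Y) /\ ~ T (map_mx ratr q *m Y) ->
    F b (map_mx ratr q *m Y) /\ ~ T (map_mx ratr q *m Y) -> a = b.
  move=> [Fa Ta] [Fb _]; apply: contrapT => ab; apply: Ta.
  exact: FF ab _ (conj Fa Fb).
apply: (@sub_countable _ _ _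
  ([set a | ~ rank_ge (F a) m.+1] `|` [set a | rank_ge (F a) n])).
  exact: subset_card_le.
apply: countableU.
  apply: (countable_code _ (inj _ X)) => a /= nr.
  have [p Fp Tp] := newpt a.
  have /submxP[c pE] : (p <= X)%MS.
    apply: contrapT => /negP pX; apply: nr; apply: rank_ge_ext fX _ Fp pX.
    by move=> i; exact/TF.
  rewrite pE in Fp Tp; apply: (@exists_rat_point _ X 1%:M _ _ c) => //.
    exact: unitmx1.
  by move=> i; rewrite mul1mx; exact/TF.
apply: (countable_code _ (inj _ 1%:M)) => a /= [Xa fXa FXa].
have [p Fp Tp] := newpt a.
apply: (@exists_rat_point _ 1%:M Xa _ _ p); rewrite ?mulmx1//.
by rewrite -row_free_unit.
Qed.

Lemma countable_avoid (D : set R) : countable D -> exists a, ~ D a.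
Proof.
move=> cD; apply: contrapT => h; apply: (uncountable_reals cD (f := fun=> 0%N)).
by move=> a b /set_mem nD; case: h; exists a.
Qed.

End Rank.

(** * Rank bounds for images of simplicial cones *)

Section RankEndo.
Context {R : realType} {n : nat}.
Local Notation V := 'rV[R]_n.
Implicit Types (A B K T : set V) (x y u v p : V).
Context (s : set V -> set V) (hs : PC_endo s).
Context (n2 : (2 <= n)%N) (nonconst : s set0 <> s setT).

(** The adjoined rays are those of [y a = e + a *: f], with [e] and [f] independent modulo the rows
    of [X]; this uses the two spare dimensions. Distinct cones [K a] meet in the cone of [X], so
    only countably many [a] are bad. *)
Lemma endo_simplex_cone_step j (X : 'M[R]_(j, n)) m : (j.+2 <= n)%N ->
  row_free X -> rank_ge (s (simplex_cone X)) m ->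
  exists v, [/\ row_free (col_mx X v),
    rank_ge (s (simplex_cone (col_mx X v))) m.+1 &
    ~ rank_ge (s (simplex_cone (col_mx X v))) n].
Proof.
move=> jn fX rX.
have [e fXe] := exists_row_free_col_mx fX (ltnW jn).
have jn1 : (j + 1 < n)%N by rewrite addn1.
have [f fXef] := exists_row_free_col_mx fXe jn1.
have ind (a : 'rV[R]_j) (b c : R) : a *m X + b *: e + c *: f = 0 ->
    [/\ a = 0, b = 0 & c = 0].
  rewrite -(mul_scalar_mx b) -(mul_scalar_mx c) -!mul_row_col => /eqP.
  rewrite mulmx_free_eq0// => /eqP E.
  have := congr1 (fun M => rsubmx M 0 0) E; have := congr1 lsubmx E.
  rewrite row_mxKr row_mxKl raddf0 !mxE mulr1n => {}E c0.
  have := congr1 (fun M => rsubmx M 0 0) E; have := congr1 lsubmx E.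
  by rewrite row_mxKr row_mxKl raddf0 !mxE mulr1n.
pose y a : V := e + a *: f; pose K a := simplex_cone (col_mx X (y a)).
have ind2 (c : 'rV[R]_j) (a b : R) : c *m X + b *: y a = 0 -> c = 0 /\ b = 0.
  by rewrite /y scalerDr scalerA addrA => /ind[].
have fXy a : row_free (col_mx X (y a)).
  apply: inj_row_free => w; rewrite -[w]hsubmxK mul_row_col.
  rewrite [rsubmx w]mx11_scalar mul_scalar_mx => /ind2[-> ->].
  by rewrite raddf0 row_mx0.
have PX := in_PC_simplex_cone fX.
have PK a : in_PC (K a) by exact: in_PC_simplex_cone.
have y0 a : y a != 0.
  apply/eqP => ya0; have [|_] := ind2 0 a 1; last by lra.
  by rewrite mul0mx scale1r add0r.
have Ky a : K a (y a).
  have := simplex_cone_row (col_mx X (y a)) (rshift j ord0).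
  by rewrite rowKd row_id.
have XK a : simplex_cone X `<=` K a.
  move=> _ [c [c0 c1] <-]; apply/simplex_cone_col_mxP; exists c, 0.
  by rewrite addr0 scale0r addr0.
have Xy a : simplex_cone X `&` ray (y a) = set0.
  apply/seteqP; split=> // _ [[c [c0 c1] <-] [l /= l1 ly]].
  have [|_] := ind2 c a (- l); last by lra.
  by rewrite scaleNr ly subrr.
have [|||||a] := @countable_avoid _ _ (@countable_rank_exceptions _ _
    (s (simplex_cone X)) (fun a => s (K a)) m _ _ _ _ _ rX).
- exact: endo_in_PC.
- by move=> a; exact: endo_in_PC.
- by move=> a; exact: endo_sub.
(* If the image did not grow, [s (ray (y a))] would lie in the image of the disjoint cone of [X],
   hence equal [s set0]. *)
- move=> a E; apply: (endo_ray_neq0 hs n2 nonconst (y0 a)).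
  have Py := in_PC_ray (y0 a).
  rewrite -(Xy a) endoI//; apply/esym/setIidr; rewrite -E.
  by apply: endo_sub => //; exact: ray_sub.
- move=> a b ab; rewrite -endoI//; apply: endo_sub => //; first exact: in_PCI.
  move=> v [/simplex_cone_col_mxP[c [l [c0 l0 cl ->]]]].
  move=> /simplex_cone_col_mxP[d [k [d0 k0 dk E]]].
  have [|_ l1 l2] := ind (c - d) (l - k) (l * a - k * b).
    rewrite mulmxBl; move: (c *m X) (d *m X) E => u v' /rowP E.
    apply/rowP => i; have := E i; rewrite !mxE => /eqP.
    by rewrite -subr_eq0 => /eqP <-; ring.
  have lk : l = k by lra.
  have {}l0 : l = 0.
    have /eqP : l * (a - b) = 0 by rewrite -lk in l2; lra.
    by rewrite mulf_eq0 subr_eq0 => /orP[/eqP//|/eqP].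
  exists c; last by rewrite l0 scale0r addr0.
  by split => //; rewrite l0 addr0 in cl.
- move=> /not_orP[/contrapT r1 r2].
  by exists (y a).
Qed.

(** Each step raises both the dimension of the cone and the rank of the image by one. The last one
    reaches dimension [n - 1] with rank still below [n], so the rank never exceeds the dimension. As
    [j <= n - 2], rays are covered only when [n >= 3]. *)
Lemma endo_simplex_cone_rank k j (X : 'M[R]_(j, n)) m : (j + k.+2 = n)%N ->
  row_free X -> rank_ge (s (simplex_cone X)) m -> (m <= j)%N.
Proof.
elim: k j X m => [|k IH] j X m jkn fX rX.
  have [|v [fv rv nrv]] := endo_simplex_cone_step _ fX rX.
    by rewrite -jkn addn2.
  have := rank_ge_le rv; rewrite leq_eqVlt => /orP[/eqP mn|].
    by rewrite mn in rv.
  by rewrite -jkn addn2.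
have [|v [fv rv _]] := endo_simplex_cone_step _ fX rX.
  by rewrite -jkn !addnS !ltnS leqW// leq_addr.
by have := IH _ _ _ _ fv rv; rewrite addn1 ltnS; apply; rewrite addSnnS.
Qed.

End RankEndo.

(** * Traces of pseudo-cones on rays and half-spaces *)

Section RayTrace.
Context {R : realType} {n : nat}.
Local Notation V := 'rV[R]_n.
Implicit Types (A B K T : set V) (x y u v p : V).

(** By the bipolar theorem, [c p] lies in [K] iff [c >= 1 / (- <p, v>)] for every [v] in the dual;
    the threshold is the supremum of these bounds. *)
Lemma ray_trace K p : in_PC K -> ~ K 0 -> K p ->
  exists2 c0 : R, 0 < c0 & forall c, 0 < c -> K (c *: p) <-> c0 <= c.
Proof.
move=> PK K0 Kp; pose E := [set (- dot p v)^-1 | v in dual_set K].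
have Kpv v : dual_set K v -> dot p v <= -1 by move=> /(_ _ Kp); rewrite dotC.
have [v0 Dv0] : dual_set K !=set0.
  apply/set0P/eqP => D0; apply: K0.
  by rewrite -(in_PC_bidual PK) D0 dual_set_set0.
have supE : has_sup E.
  split; first by exists (- dot p v0)^-1, v0.
  exists 1 => _ [v /Kpv pv <-]; rewrite invf_le1; lra.
exists (sup E).
  apply: (@lt_le_trans _ _ (- dot p v0)^-1).
    by have := Kpv _ Dv0; rewrite invr_gt0; lra.
  by apply: sup_upper_bound => //; exists v0.
move=> c c0; rewrite -{1}(in_PC_bidual PK); split=> [h|h v Dv].
  apply: ge_sup; first by case: supE.
  move=> _ [v Dv <-]; have := h _ Dv; rewrite dotZl => hv.
  have pv := Kpv _ Dv; have pv0 : 0 < - dot p v by lra.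
  by rewrite -(@ler_pM2r _ (- dot p v))// mulVf ?gt_eqF//; lra.
have pv := Kpv _ Dv; have pv0 : 0 < - dot p v by lra.
have : (- dot p v)^-1 <= c.
  by apply: le_trans h; apply: sup_upper_bound => //; exists v.
rewrite -(@ler_pM2r _ (- dot p v))// mulVf ?gt_eqF// dotZl; lra.
Qed.

Lemma ray_trace_eq K p : in_PC K -> ~ K 0 -> p != 0 ->
  ray p `&` K = set0 \/
  exists2 c : R, 1 <= c & ray p `&` K = ray (c *: p).
Proof.
move=> PK K0 p0; have [->|/eqP/set0P[_ [[l /= l1 <-] Klp]]] :=
  pselect (ray p `&` K = set0); first by left.
right; have [c0 c00 hc] := ray_trace PK K0 Klp.
have hK c : 0 < c -> K (c *: p) <-> c0 * l <= c.
  move=> cgt0; rewrite -ler_pdivlMr; last by lra.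
  rewrite -hc ?divr_gt0//; last by lra.
  by rewrite scalerA divfK// gt_eqF//; lra.
(* The threshold along [p] is [c0 * l], since [c0] refers to [l *: p]; the maximum with [1]
   restricts to [ray p]. *)
exists (Num.max 1 (c0 * l)); first by rewrite le_max lexx.
have m0 : 0 < Num.max 1 (c0 * l) by rewrite lt_max ltr01.
apply/seteqP; split=> [_ [[c /= c1 <-]]|_ [k /= k1 <-]].
  rewrite hK; last by lra.
  move=> cl; exists (c / Num.max 1 (c0 * l)).
    by rewrite /= ler_pdivlMr// mul1r ge_max c1.
  by rewrite scalerA divfK// gt_eqF.
have h : Num.max 1 (c0 * l) <= k * Num.max 1 (c0 * l) by rewrite ler_peMl// ltW.
rewrite scalerA; split.
  by apply: rayZ; apply: le_trans h; rewrite le_max lexx.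
apply/hK; first by apply: lt_le_trans h.
by apply: le_trans h; rewrite le_max lexx orbT.
Qed.

Lemma rank_ge_setT m : (m <= n)%N -> rank_ge (setT : set V) m.
Proof.
move=> mn; exists (pid_mx m) => //.
by rewrite /row_free rank_pid_mx.
Qed.

Lemma rank_ge1 K p : K p -> p != 0 -> rank_ge K 1.
Proof.
by move=> Kp p0; exists p => [|i]; [exact: row_free_rV | rewrite ord1 row_id].
Qed.

Lemma rank1_ray K : in_PC K -> (2 <= n)%N -> K !=set0 -> ~ rank_ge K 2 ->
  exists2 v, v != 0 & K = ray v.
Proof.
move=> PK n2 [p Kp] rK.
have K0 : ~ K 0.
  move=> /(in_PC_has0 PK) E; apply: rK; rewrite E; exact: rank_ge_setT.
have p0 : p != 0 by apply/eqP => p0; rewrite p0 in Kp.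
have [c0 c00 hc] := ray_trace PK K0 Kp.
exists (c0 *: p); first by rewrite scaler_eq0 negb_or p0 gt_eqF.
apply/seteqP; split; last by apply: ray_sub => //; exact/hc.
move=> q Kq; have /sub_rVP[c qE] : (q <= p)%MS.
  apply: contrapT => /negP qp; apply: rK.
  apply: rank_ge_ext (row_free_rV p0) _ Kq qp => i.
  by rewrite ord1 row_id.
rewrite qE in Kq *; have cpos : 0 < c.
  rewrite ltNge; apply/negP => c_le0; apply: K0.
  (* For [c <= 0] the origin lies on the segment from [c *: p] to [p]. *)
  have -> : 0 = (1 - c)^-1 *: (c *: p) + (1 - (1 - c)^-1) *: p :> V.
    rewrite scalerA -scalerDl (_ : _ + _ = 0) ?scale0r//.
    by field; rewrite gt_eqF//; lra.
  have /convex_subsetP := in_PC_convex PK; apply => //.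
  by rewrite invr_ge0 invf_le1; lra.
exists (c / c0); first by rewrite /= ler_pdivlMr// mul1r -hc.
by rewrite scalerA divfK// gt_eqF.
Qed.

(* Each segment from a point of [S] to [p] leaves both half-spaces at the same
   point; comparing [q] and [2 q] removes the dependence on [p]. *)
Lemma halfspace_traces_orthogonal S T p v w : in_PC S -> in_PC T ->
  S = T `&` dual_set (ray v) -> S = T `&` dual_set (ray w) -> T p -> ~ S p ->
  forall q, S q -> dot q (v - w) = 0.
Proof.
move=> PS PT Sv Sw Tp Sp.
have pv : -1 < dot p v.
  rewrite ltNge; apply/negP => h; apply: Sp; rewrite Sv; split=> //.
  exact/dual_rayP.
have pw : -1 < dot p w.
  rewrite ltNge; apply/negP => h; apply: Sp; rewrite Sw; split=> //.
  exact/dual_rayP.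
have Sle q : S q -> dot q v <= -1 /\ dot q w <= -1.
  move=> Sq; split; apply/dual_rayP; first by move: Sq; rewrite Sv => -[].
  by move: Sq; rewrite Sw => -[].
have ST q : S q -> T q by rewrite Sv => -[].
have half (a b : V) q : -1 < dot p a -> S = T `&` dual_set (ray a) ->
    (forall r, S r -> dot r b <= -1) -> S q ->
    (1 + dot q b) * (1 + dot p a) <= (1 + dot q a) * (1 + dot p b).
  move=> pa Sa Sb Sq; have qa : dot q a <= -1.
    by apply/dual_rayP; move: Sq; rewrite Sa => -[].
  pose d := dot p a - dot q a; have d0 : 0 < d by rewrite /d; lra.
  (* This is where the segment from [q] to [p] crosses the hyperplane [<., a> = -1]. *)
  pose t := - (1 + dot q a) / d; have td : t * d = - (1 + dot q a).
    by rewrite /t divfK// gt_eqF.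
  have : S (t *: p + (1 - t) *: q).
    rewrite Sa; split; last first.
      apply/dual_rayP; rewrite dotDl !dotZl; rewrite /d in td; lra.
    have /convex_subsetP := in_PC_convex PT; apply => //; first exact: ST.
    apply/andP; split; first by rewrite divr_ge0 ?(ltW d0)//; lra.
    by rewrite ler_pdivrMr// mul1r /d; lra.
  move/Sb; rewrite dotDl !dotZl => h.
  have : (t * dot p b + (1 - t) * dot q b) * d <= -1 * d by rewrite ler_pM2r.
  have -> : (t * dot p b + (1 - t) * dot q b) * d =
      - (1 + dot q a) * dot p b + (1 + dot p a) * dot q b.
    transitivity (t * d * dot p b + (d - t * d) * dot q b); first by ring.
    by rewrite td /d; ring.
  by rewrite /d; nra.
have eqq q : S q ->
    (1 + dot q v) * (1 + dot p w) = (1 + dot q w) * (1 + dot p v).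
  move=> Sq; apply/eqP; rewrite eq_le.
  by rewrite (half w v)//= ?(half v w)// => r /Sle[].
move=> q Sq; have := eqq _ Sq; have := eqq (2 *: q); rewrite !dotZl.
have S2 : S (2 *: q) by apply: in_PC_scale => //; lra.
move=> /(_ S2) e2 e1; have [qv qw] := Sle _ Sq.
(* Twice [e1] minus [e2]. *)
have e3 : dot p v = dot p w by nra.
have e4 : (dot q v - dot q w) * (1 + dot p w) = 0 by rewrite e3 in e1; nra.
rewrite dotDr dotNr; move/eqP: e4; rewrite mulf_eq0 => /orP[/eqP//|].
by rewrite gt_eqF//; lra.
Qed.

End RayTrace.

(** * Images of the empty set and of rays *)

Section EndoRays.
Context {R : realType} {n : nat}.
Local Notation V := 'rV[R]_n.
Context (n2 : (2 <= n)%N).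
Implicit Types (s : set V -> set V) (x y u v p : V).

(** The empty set is the simplicial cone on no rows, so its image has rank [0], while a nonempty
    image would have rank at least [1], even if it contains the origin. *)
Lemma endo_set0 s : PC_endo s -> s set0 <> s setT -> s set0 = set0.
Proof.
move=> hs nc; apply: contrapT => /eqP/set0P[p sp].
have P0 := endo_in_PC hs (in_PC0 : in_PC (set0 : set V)).
have r1 : rank_ge (s set0) 1.
  have [p0|] := eqVneq p 0; last exact: rank_ge1.
  rewrite p0 in sp; rewrite (in_PC_has0 P0 sp); apply: rank_ge_setT.
  exact: ltnW.
have r0 : rank_ge (s (simplex_cone (0 : 'M[R]_(0, n)))) 1.
  by rewrite simplex_cone_empty.
suff : (1 <= 0)%N by [].
apply: (endo_simplex_cone_rank hs n2 nc (k := n - 2)) r0.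
  by rewrite add0n -addn2 subnK.
by apply: inj_row_free => v _; apply/rowP => -[].
Qed.

Lemma endo_dual_nonconst s : PC_endo s -> s set0 <> s setT ->
  dual_set (s (dual_set set0)) <> dual_set (s (dual_set setT)).
Proof.
move=> hs nc; rewrite dual_set_set0 dual_set_setT => E; apply: nc.
have P0 := endo_in_PC hs in_PC0; have PT := endo_in_PC hs in_PCT.
by rewrite -(in_PC_bidual P0) -E in_PC_bidual.
Qed.

Lemma endo_ray_rank s x : PC_endo s -> s set0 <> s setT -> (3 <= n)%N ->
  x != 0 -> ~ rank_ge (s (ray x)) 2.
Proof.
move=> hs nc n3 x0; rewrite ray_simplex_cone => r2; suff : (2 <= 1)%N by [].
apply: (endo_simplex_cone_rank hs n2 nc (k := n - 3)) r2.
  by rewrite add1n -addn3 subnK.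
exact: row_free_rV.
Qed.

(* In the plane, all but countably many half-planes through [x] are mapped to
   half-planes; two of them suffice. *)
Lemma endo_ray_rank2 s x : PC_endo s -> s set0 <> s setT -> n = 2%N ->
  x != 0 -> ~ rank_ge (s (ray x)) 2.
Proof.
move=> hs nc n_eq2 x0; set sd := fun K => dual_set (s (dual_set K)).
have hsd : PC_endo sd := PC_endo_dual hs.
have ncd : sd set0 <> sd setT := endo_dual_nonconst hs nc.
have [w xw] := exists_indep n2 x0.
have [xi [om [xix xiw omx omw]]] := dual_pair xw.
pose u a : V := a *: om - xi.
have ux a : dot (u a) x = -1.
  by rewrite /u dotDl dotNl dotZl xix omx mulr0 add0r.
have uw a : dot (u a) w = a.
  by rewrite /u dotDl dotNl dotZl xiw omw mulr1 subr0.
have u0 a : u a != 0.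
  by apply/eqP => ua; have := ux a; rewrite ua dot0l; lra.
have Pu a := in_PC_ray (u0 a).
have disj a b : a <> b -> ray (u a) `&` ray (u b) = set0.
  move=> ab; apply: ray_disjoint => c _; apply/eqP => e; apply: ab.
  have := ux b; rewrite e dotZl ux => ec; have := uw b; rewrite e dotZl uw; nra.
have P0 := endo_in_PC hsd in_PC0.
have cnt : countable [set a | ~ rank_ge (sd (ray (u a))) 1 \/
    rank_ge (sd (ray (u a))) n].
  apply: (@countable_rank_exceptions _ _ (sd set0)) => //.
  - by move=> a; apply: endo_in_PC.
  - by move=> a; apply: endo_sub => //; exact: in_PC0.
  - by move=> a; apply: endo_ray_neq0.
  - by move=> a b ab; rewrite -(endoI hsd)// disj.
  - by exists 0 => [|[]//]; apply: inj_row_free => v _; apply/rowP => -[].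
have good a : ~ (~ rank_ge (sd (ray (u a))) 1 \/ rank_ge (sd (ray (u a))) n) ->
    exists2 v, sd (ray (u a)) = ray v &
      s (dual_set (ray (u a))) = dual_set (ray v).
  move=> /not_orP[/contrapT[X fX KX]]; rewrite [X in rank_ge _ X]n_eq2 => r2.
  have [||v v0 E] := rank1_ray _ n2 _ r2.
  - by apply: endo_in_PC.
  - by exists (row ord0 X).
  exists v => //; rewrite -E /sd in_PC_bidual//; apply: endo_in_PC => //.
  exact: in_PC_dual.
have [a /good[va Ea Fa]] := countable_avoid cnt.
have [b] := countable_avoid (countableU cnt (countable1 a)).
move=> /not_orP[/good[vb Eb Fb] /= ba].
(* All these half-spaces have [x] on their boundary, so each cuts the longer ray exactly at [x]. *)
have half c : ray x = ray (2^-1 *: x) `&` dual_set (ray (u c)).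
  apply/seteqP; split.
    move=> _ [l /= l1 <-]; split.
      exists (2 * l); first by rewrite /=; lra.
      by rewrite scalerA mulrAC divff ?mul1r.
    by apply/dual_rayP; rewrite dotZl dotC ux; lra.
  move=> z [[l /= l1 <-]] /dual_rayP; rewrite !dotZl dotC ux => h.
  by exists (l / 2); [rewrite /=; lra | rewrite scalerA].
have x20 : 2^-1 *: x != 0 by rewrite scaler_eq0 negb_or x0 invr_eq0 pnatr_eq0.
have Px := in_PC_ray x0; have Px2 := in_PC_ray x20.
have Sc c : s (ray x) = s (ray (2^-1 *: x)) `&` s (dual_set (ray (u c))).
  by rewrite {1}(half c) endoI//; exact: in_PC_dual.
have [p Tp Sp] : exists2 p, s (ray (2^-1 *: x)) p & ~ s (ray x) p.
  apply: contrapT => h.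
  apply: (endo_ray_scale_neq hs n2 nc x20 (_ : 1 < 2)); first by lra.
  rewrite scalerA divff// scale1r; apply/seteqP; split.
    by rewrite (Sc a); exact: subIsetl.
  by move=> p Tp; apply: contrapT => Sp; apply: h; exists p.
move=> [X fX SX].
have orth := halfspace_traces_orthogonal (endo_in_PC hs Px) (endo_in_PC hs Px2)
  (etrans (Sc a) (congr1 _ Fa)) (etrans (Sc b) (congr1 _ Fb)) Tp Sp.
(* [va - vb] is orthogonal to [s (ray x)], which spans the plane by assumption. *)
have vab : va = vb.
  apply/eqP; rewrite -subr_eq0; apply/eqP/dot_eq0.
  have /submxP[c cX] : (va - vb <= X)%MS.
    by apply: submx_full; rewrite /row_full (eqP fX) n_eq2.
  rewrite dot_mulmx {1}cX -mulmxA (_ : X *m _ = 0) ?mulmx0 ?mxE//.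
  apply/colP => i; rewrite [RHS]mxE -(orth _ (SX i)) dot_mulmx !mxE.
  by apply: eq_bigr => j _; rewrite !mxE.
apply: (endo_ray_neq0 hsd n2 ncd (u0 a)).
by rewrite -(disj _ _ ba) (endoI hsd)// Ea Eb vab setIid.
Qed.

Lemma endo_ray_ray s x : PC_endo s -> s set0 <> s setT -> x != 0 ->
  exists2 v, v != 0 & s (ray x) = ray v.
Proof.
move=> hs nc x0; apply: rank1_ray => //.
  exact: (endo_in_PC hs (in_PC_ray x0)).
- apply/set0P/eqP => E; apply: (endo_ray_neq0 hs n2 nc x0).
  by rewrite E endo_set0.
- move: (n2); rewrite leq_eqVlt => /orP[/eqP n_eq2|n3].
    exact: endo_ray_rank2.
  exact: endo_ray_rank.
Qed.

End EndoRays.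

(** [A] is monotone and fixes the naturals. As [k a] lies between consecutive naturals, so does
    [A (k a) = k A a]; hence [k |A a - a| <= 1] for all [k]. *)
Lemma positive_additive_id (R : realType) (A : R -> R) :
  {morph A : a b / a + b} -> A 1 = 1 -> (forall a, 0 <= a -> 0 <= A a) ->
  forall a, A a = a.
Proof.
move=> AD A1 A_ge0.
have A0 : A 0 = 0 by have := AD 0 0; rewrite addr0; lra.
have AN a : A (- a) = - A a by have := AD a (- a); rewrite subrr A0; lra.
have Amono a b : a <= b -> A a <= A b.
  by move=> ab; have := A_ge0 (b - a); rewrite subr_ge0 AD AN subr_ge0; apply.
have Anat (k : nat) a : A (k%:R * a) = k%:R * A a.
  elim: k => [|k IH]; first by rewrite !mul0r.
  by rewrite -natr1 !mulrDl !mul1r AD IH.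
have Apos a : 0 <= a -> A a = a.
  move=> a0; apply: contrapT => /eqP; rewrite -subr_eq0 => d0.
  set d := A a - a in d0; have dpos : 0 < `|d| by rewrite normr_gt0.
  pose k := Num.bound `|d|^-1; have : `|d|^-1 < k%:R.
    by apply: archi_boundP; rewrite invr_ge0 ltW.
  rewrite -(@ltr_pM2r _ `|d|)// mulVf ?gt_eqF// => kd.
  have ka0 : 0 <= k%:R * a by rewrite mulr_ge0.
  have /andP[h1 h2] := truncn_itv ka0; set m := Num.truncn _ in h1 h2.
  have Am (j : nat) : A j%:R = j%:R by rewrite -[j%:R]mulr1 Anat A1.
  have := Amono _ _ h1; have := Amono _ _ (ltW h2); rewrite !Am Anat => h3 h4.
  have : k%:R * `|d| <= 1.
    have -> : k%:R * `|d| = `|k%:R * A a - k%:R * a|.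
      by rewrite -mulrBr normrM (ger0_norm (ler0n _ _)).
    rewrite -natr1 in h2 h3; rewrite ler_norml; apply/andP; split; lra.
  lra.
move=> a; have [/Apos//|a0] := leP 0 a.
have : A (- a) = - a by apply: Apos; lra.
by rewrite AN; lra.
Qed.

(** * Incidence-preserving maps *)

Section Rigidity.
Context {R : realType} {n : nat} (n2 : (2 <= n)%N).
Local Notation V := 'rV[R]_n.
Local Notation e i := (delta_mx 0 i : V).
Implicit Types (x y u v : V).

Lemma delta_rV_neq0 i : e i != 0.
Proof.
by apply/eqP => /rowP/(_ i); rewrite !mxE !eqxx => /eqP; rewrite oner_eq0.
Qed.

Lemma scale_delta_neq0 i (c : R) : c != 0 -> c *: e i != 0.
Proof. by move=> c0; rewrite scaler_eq0 negb_or c0 delta_rV_neq0. Qed.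

(** The value [1] stands for the [-1] of duality after a sign change in the second argument, so that
    the standard basis is dual to itself. *)
Definition incidence_morphism (f g : V -> V) := forall x u, x != 0 -> u != 0 ->
  (dot x u = 1 -> dot (f x) (g u) = 1) /\ (dot x u = 0 -> dot (f x) (g u) = 0).

Lemma incidence_morphism_sym f g :
  incidence_morphism f g -> incidence_morphism g f.
Proof.
by move=> fg x u x0 u0; rewrite !(dotC _ u) !(dotC _ (f u)); exact: fg.
Qed.

(** The value at [0] is imposed because incidences say nothing about [f 0]. *)
Definition axis (f : V -> V) i (c : R) : R :=
  if c == 0 then 0 else f (c *: e i) 0 i.

Lemma axis0 f i : axis f i 0 = 0.
Proof. by rewrite /axis eqxx. Qed.

Lemma axis1 f i : f (e i) = e i -> axis f i 1 = 1.
Proof. by move=> fe; rewrite /axis oner_eq0 scale1r fe mxE !eqxx. Qed.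

(** Vanishing coordinates are preserved, as they are incidences with basis vectors. If [x_i = c] is
    nonzero, pairing with [c^-1 e_i] determines the [i]-th coordinate of [f x] from [c] alone. *)
Lemma coord_axis f g : incidence_morphism f g -> (forall i, g (e i) = e i) ->
  (forall i, f (e i) = e i) -> forall x i, x != 0 -> f x 0 i = axis f i (x 0 i).
Proof.
move=> fg ge fe x i x0; have zero y j : y != 0 -> y 0 j = 0 -> f y 0 j = 0.
  move=> y0 yj; rewrite -dot_deltar -(ge j).
  by apply: (fg _ _ y0 (delta_rV_neq0 j)).2; rewrite dot_deltar.
have gzero u j : u != 0 -> u 0 j = 0 -> g u 0 j = 0.
  move=> u0 uj; rewrite -dot_deltal -(fe j).
  by apply: (fg _ _ (delta_rV_neq0 j) u0).2; rewrite dot_deltal.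
rewrite /axis; case: eqVneq => [|xi0]; first exact: zero.
set c := x 0 i in xi0 *; have ci0 : c^-1 != 0 by rewrite invr_eq0.
have prod y : y != 0 -> y 0 i = c -> f y 0 i * g (c^-1 *: e i) 0 i = 1.
  move=> y0 yi; have ue0 := scale_delta_neq0 i ci0.
  have := (fg _ _ y0 ue0).1; rewrite dotZr dot_deltar yi mulVf// => /(_ erefl).
  rewrite /dot (bigD1 i)//= big1 ?addr0// => j ji.
  by rewrite (gzero _ j) ?mulr0// !mxE (negbTE ji) andbF mulr0.
have ne0 := scale_delta_neq0 i xi0.
have p1 := prod x x0 erefl; have p2 := prod _ ne0.
have /p2 {}p2 : (c *: e i) 0 i = c by rewrite !mxE !eqxx mulr1.
have g0 : g (c^-1 *: e i) 0 i != 0.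
  by apply: contra_eq_neq p1 => ->; rewrite mulr0 eq_sym oner_eq0.
by apply: (mulIf g0); rewrite p1 p2.
Qed.

(** Incidences between vectors supported on two coordinates make the axis maps multiplicative and
    additive. Squares go to squares, so positivity is preserved and each axis map is the
    identity. *)
Lemma incidence_rigid f g : incidence_morphism f g ->
  (forall i, f (e i) = e i) -> (forall i, g (e i) = e i) ->
  forall x, x != 0 -> f x = x.
Proof.
move=> fg fe ge.
have fP := coord_axis fg ge fe.
have gP := coord_axis (incidence_morphism_sym fg) fe ge.
have other j : exists i : 'I_n, i != j by exact: exists_neq_ord.
have pair_neq0 i j (a b : R) : i != j -> (a != 0) || (b != 0) ->
    a *: e i + b *: e j != 0.
  move=> ij ab; apply/eqP => /rowP h; have := h i; have := h j.
  rewrite !mxE !eqxx (negbTE ij) eq_sym (negbTE ij) !mulr0 !mulr1 addr0 add0r.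
  by move=> b0 a0; move: ab; rewrite a0 b0 eqxx.
have dot2 v i j (a b : R) : dot v (a *: e i + b *: e j) = v 0 i * a + v 0 j * b.
  by rewrite dotDr !dotZr !dot_deltar; ring.
have pair_coord i j (a b : R) : i != j ->
    ((a *: e i + b *: e j) 0 i = a) * ((a *: e i + b *: e j) 0 j = b).
  move=> ij; rewrite !mxE !eqxx (negbTE ij) eq_sym (negbTE ij).
  by rewrite !mulr0 !mulr1 addr0 add0r.
have gpair i j (a b : R) : i != j -> (a != 0) || (b != 0) ->
    g (a *: e i + b *: e j) = axis g i a *: e i + axis g j b *: e j.
  move=> ij ab; apply/rowP => k; rewrite gP; last exact: pair_neq0.
  rewrite !mxE; have [->|ki] := eqVneq k i.
    by rewrite (negbTE ij) !eqxx/= !mulr1 !mulr0 !addr0.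
  have [->|kj] := eqVneq k j; first by rewrite !eqxx/= !mulr1 !mulr0 !add0r.
  by rewrite /= !mulr0 addr0 axis0.
have rel i j (a b c d : R) : i != j -> (a != 0) || (b != 0) ->
    (c != 0) || (d != 0) ->
    (a * c + b * d = 1 ->
      axis f i a * axis g i c + axis f j b * axis g j d = 1) /\
    (a * c + b * d = 0 ->
      axis f i a * axis g i c + axis f j b * axis g j d = 0).
  move=> ij ab cd; have x0 := pair_neq0 _ _ _ _ ij ab.
  have u0 := pair_neq0 _ _ _ _ ij cd.
  have := fg _ _ x0 u0; rewrite gpair// !dot2 !fP//.
  by rewrite !(pair_coord i j a b ij).
have f1 i := axis1 (fe i); have g1 i := axis1 (ge i).
(* From the orthogonality of [e_i + c e_j] and [- c r e_i + r e_j]. *)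
have prod i j c r : i != j ->
    axis g i (- (c * r)) = - (axis f j c * axis g j r).
  move=> ij; have [->|r0] := eqVneq r 0.
    by rewrite mulr0 oppr0 !axis0 mulr0 oppr0.
  have := (rel i j 1 c (- (c * r)) r ij _ _).2; rewrite oner_neq0 r0 orbT.
  by move=> /(_ isT isT); rewrite f1 => h; have := h; lra.
have neg i j r : i != j -> axis g i (- r) = - axis g j r.
  by move=> ij; have := prod i j 1 r ij; rewrite mul1r f1 mul1r.
have fgE j c : axis f j c = axis g j c.
  have [i ij] := other j; have := prod i j c 1 ij.
  by rewrite mulr1 g1 mulr1 (neg i j)// => /oppr_inj.
have mul j c r : axis g j (c * r) = axis g j c * axis g j r.
  have [i ij] := other j; have := prod i j c r ij.
  by rewrite (neg i j)// fgE => /oppr_inj.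
have odd j r : axis g j (- r) = - axis g j r.
  have gm1 : axis g j (-1) = -1.
    by have [i ij] := other j; rewrite eq_sym in ij; rewrite (neg j i)// g1.
  by rewrite -mulN1r mul gm1 mulN1r.
have add j : {morph axis g j : a b / a + b}.
  (* From the pairing of [e_i + e_j] with [s e_i + (1 - s) e_j]; multiplicativity then rescales this
     to any nonzero sum [a + b]. *)
  have h s : axis g j s + axis g j (1 - s) = 1.
    have [i ij] := other j; have := (rel i j 1 1 s (1 - s) ij _ _).1.
    rewrite oner_neq0 !mul1r !f1 !mul1r.
    rewrite -[axis g j s]opprK -(neg i j)// odd opprK.
    apply=> //; last by ring.
    by have [->|//] := eqVneq s 0; rewrite subr0 oner_neq0.
  move=> a b; have [ab0|ab0] := eqVneq (a + b) 0.
    by rewrite ab0 axis0 (_ : b = - a) ?odd ?subrr//; lra.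
  rewrite -[LHS]mulr1 -(h (a / (a + b))) mulrDr -!mul.
  congr (axis g j _ + axis g j _).
    by rewrite mulrC divfK.
  by rewrite mulrBr mulr1 (mulrC (a + b)) divfK// addrC addKr.
have id j r : axis g j r = r.
  apply: positive_additive_id => // a a0.
  by rewrite -(sqr_sqrtr a0) expr2 mul -expr2 sqr_ge0.
by move=> x x0; apply/rowP => i; rewrite fP// fgE id.
Qed.

End Rigidity.

(** * Linearity of endomorphisms and return to duality *)

Section Assembly.
Context {R : realType} {n : nat} (n2 : (2 <= n)%N).
Local Notation V := 'rV[R]_n.
Implicit Types (A B K : set V) (x y u v w : V).

(** The join of independent rays misses the origin, and so does that of positively proportional
    ones, which lie in a common ray. *)
Lemma join_ray_setT v w : v != 0 -> w != 0 -> join_set (ray v) (ray w) = setT ->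
  exists2 c : R, 0 < c & w = - c *: v.
Proof.
move=> v0 w0 J; have [vw|] := pselect (indep v w).
  have : join_set (ray v) (ray w) 0 by rewrite J.
  by move=> /(join_rayP _ vw)[a [b [a0 b0 ab /esym/vw[]]]]; lra.
move=> /existsNP[a /existsNP[b /not_implyP[abE]]] abn.
have b0 : b != 0.
  apply/eqP => b0; apply: abn; split=> //; move/eqP: abE.
  by rewrite b0 scale0r addr0 scaler_eq0 (negbTE v0) orbF => /eqP.
have wE : w = - (a / b) *: v.
  apply: (scalerI b0); rewrite scalerA mulrN mulrC divfK// scaleNr.
  by apply/eqP; rewrite -addr_eq0 addrC abE.
exists (a / b) => //; rewrite ltNge; apply/negP => ab0.
have k0 : 0 < - (a / b).
  rewrite oppr_gt0 lt_neqAle ab0 andbT; apply: contra_neq w0 => c0.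
  by rewrite wE c0 oppr0 scale0r.
set k := - (a / b) in wE k0; pose m := Num.min 1 k.
have m0 : 0 < m by rewrite lt_min ltr01.
have mv0 : m *: v != 0 by rewrite scaler_eq0 negb_or v0 gt_eqF.
have Pmv := in_PC_ray mv0.
have mem c : m <= c -> ray (m *: v) (c *: v).
  move=> mc; exists (c / m); first by rewrite /= ler_pdivlMr// mul1r.
  by rewrite scalerA divfK// gt_eqF.
have : join_set (ray v) (ray w) `<=` ray (m *: v).
  apply: join_sub => //; apply: ray_sub => //.
    by rewrite -[v]scale1r scalerA mulr1; apply: mem; rewrite ge_min lexx.
  by rewrite wE; apply: mem; rewrite ge_min lexx orbT.
rewrite J => /(_ 0 I) [l /= l1 /eqP]; rewrite scaler_eq0 (negbTE mv0) orbF.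
by move=> /eqP; lra.
Qed.

Section Endo.
Context (s : set V -> set V) (hs : PC_endo s) (nc : s set0 <> s setT).

Let sd K := dual_set (s (dual_set K)).

Let hsd : PC_endo sd. Proof. exact: PC_endo_dual. Qed.

Let ncd : sd set0 <> sd setT. Proof. exact: endo_dual_nonconst. Qed.

Lemma endo_setT : s setT = setT.
Proof.
have E := endo_set0 n2 hsd ncd; rewrite /sd dual_set_set0 in E.
by rewrite -(in_PC_bidual (endo_in_PC hs in_PCT)) E dual_set_set0.
Qed.

Lemma endo_halfspace u : u != 0 ->
  exists2 v, v != 0 & s (dual_set (ray u)) = dual_set (ray v).
Proof.
move=> u0; have [v v0 E] := endo_ray_ray n2 hsd ncd u0; exists v => //.
rewrite -E /sd in_PC_bidual//; apply: (endo_in_PC hs).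
exact/in_PC_dual/in_PC_ray.
Qed.

Section Incidence.
Context (f g : V -> V).
Context (f0 : forall x, x != 0 -> f x != 0).
Context (sf : forall x, x != 0 -> s (ray x) = ray (f x)).
Context (sg : forall u, u != 0 -> s (dual_set (ray u)) = dual_set (ray (g u))).

(** The ray of [x] misses the half-space of [u], hence so do the images; a negative pairing would
    make the ray of [f x] enter that of [g u]. *)
Lemma endo_incidence0_ge0 x u : x != 0 -> u != 0 -> dot x u = 0 ->
  0 <= dot (f x) (g u).
Proof.
move=> x0 u0 xu; have Px := in_PC_ray x0; have Pu := in_PC_dual (in_PC_ray u0).
have : ray (f x) `&` dual_set (ray (g u)) = set0.
  rewrite -sf// -sg// -(endoI hs)// (_ : _ `&` _ = set0).
    exact: endo_set0.
  apply/seteqP; split=> // _ [[l /= l1 <-] /dual_rayP].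
  by rewrite dotZl xu mulr0; lra.
move=> E; rewrite leNgt; apply/negP => h.
pose l := 1 + (- dot (f x) (g u))^-1.
have h' : 0 < (- dot (f x) (g u))^-1 by rewrite invr_gt0; lra.
suff : (set0 : set V) (l *: f x) by [].
rewrite -E; split; first by apply: rayZ; rewrite /l; lra.
have hl : (- dot (f x) (g u))^-1 * (- dot (f x) (g u)) = 1.
  by rewrite mulVf// gt_eqF//; lra.
by apply/dual_rayP; rewrite dotZl /l; nra.
Qed.

(** The inequality holds for [x] and [- x], and [f (- x)] is a negative multiple of [f x] because
    the two rays join to the whole space. *)
Lemma endo_incidence0 x u : x != 0 -> u != 0 -> dot x u = 0 ->
  dot (f x) (g u) = 0.
Proof.
move=> x0 u0 xu; have x0' : - x != 0 by rewrite oppr_eq0.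
have h1 := endo_incidence0_ge0 x0 u0 xu.
have h2 : 0 <= dot (f (- x)) (g u).
  by apply: endo_incidence0_ge0 => //; rewrite dotNl xu oppr0.
have [|c c0 fN] := @join_ray_setT (f x) (f (- x)) (f0 x0) (f0 x0').
  rewrite -!sf// -(endoJ hs) ?join_ray_opp ?endo_setT//; exact: in_PC_ray.
move: h2; rewrite fN dotZl mulNr oppr_ge0 => h2.
by apply/eqP; rewrite eq_le h1 andbT; move: h2; rewrite pmulr_rle0.
Qed.

(** The ray of [x] is the trace of the longer ray of [x / 2] on the half-space of [u], so the ray of
    [f x] must start on the boundary of the image half-space. *)
Lemma endo_incidence1 x u : x != 0 -> u != 0 -> dot x u = -1 ->
  dot (f x) (g u) = -1.
Proof.
move=> x0 u0 xu; pose y := 2^-1 *: x.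
have xy : x = 2 *: y by rewrite /y scalerA divff// scale1r.
have y0 : y != 0 by rewrite scaler_eq0 negb_or x0 invr_eq0 pnatr_eq0.
have Px := in_PC_ray x0; have Py := in_PC_ray y0.
have Pu := in_PC_dual (in_PC_ray u0).
have E : ray (f x) = ray (f y) `&` dual_set (ray (g u)).
  rewrite -!sf// -sg// -(endoI hs)//; congr s; apply/seteqP; split.
    move=> _ [l /= l1 <-]; split.
      by rewrite xy scalerA; apply: rayZ; lra.
    by apply/dual_rayP; rewrite dotZl xu; lra.
  move=> _ [[l /= l1 <-]] /dual_rayP; rewrite /y !dotZl xu => h.
  by rewrite scalerA; apply: rayZ; lra.
have [[r /= r1 fxr] /dual_rayP fu] : (ray (f y) `&` dual_set (ray (g u))) (f x).
  by rewrite -E; exact: ray_self.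
apply/eqP; rewrite eq_le fu /= leNgt; apply/negP => k1.
have {}r1 : 1 < r.
  rewrite lt_neqAle r1 andbT; apply/eqP => r1'.
  apply: (endo_ray_scale_neq hs n2 nc y0 (_ : 1 < 2)); first by lra.
  by rewrite -xy !sf// -fxr -r1' scale1r.
(* The least factor that keeps [t *: f x] both in the half-space and on the ray of [f y]; being
   below [1], it leaves [ray (f x)]. *)
set k := dot _ _ in fu k1; pose t := Num.max (- k)^-1 r^-1.
have t1 : t < 1 by rewrite gt_max !invf_lt1//; lra.
have tr : 1 <= t * r.
  by rewrite -ler_pdivrMr ?div1r ?le_max ?lexx ?orbT//; lra.
have tk : t * k <= -1.
  have : 1 <= t * (- k); last by rewrite mulrN; lra.
  by rewrite -ler_pdivrMr ?div1r ?le_max ?lexx//; lra.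
have : ray (f x) (t *: f x).
  rewrite E; split; last by apply/dual_rayP; rewrite dotZl.
  by rewrite -fxr scalerA; apply: rayZ.
by move=> /(rayZP _ (f0 x0)); lra.
Qed.

Lemma endo_rays_linear : exists2 F : 'M[R]_n, F \in unitmx &
  forall x, x != 0 -> f x = x *m F.
Proof.
pose e i : V := delta_mx 0 i.
have e0 i : e i != 0 by exact: delta_rV_neq0.
have e0' i : - e i != 0 by rewrite oppr_eq0.
pose F : 'M[R]_n := \matrix_i f (e i).
(* The two signs turn the incidence value [-1] into [1], so that the rows of [F] and [G] are dual
   bases. *)
pose G : 'M[R]_n := \matrix_i - g (- e i).
have FG : F *m G^T = 1%:M.
  apply/matrixP => i j; rewrite [RHS]mxE.
  have -> : (F *m G^T) i j = dot (f (e i)) (- g (- e j)).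
    by rewrite !mxE; apply: eq_bigr => k _; rewrite !mxE.
  rewrite dotNr; have [->|ij] := eqVneq i j.
    rewrite (endo_incidence1 (e0 j) (e0' j)) ?opprK//.
    by rewrite dotNr dot_deltar mxE !eqxx.
  rewrite (endo_incidence0 (e0 i) (e0' j)) ?oppr0//.
  by rewrite dotNr dot_deltar mxE eq_sym (negbTE ij) oppr0.
have [uF _] := mulmx1_unit FG; exists F => // x x0.
have GF : G *m F^T = 1%:M.
  by apply: trmx_inj; rewrite trmx_mul trmxK FG trmx1.
suff fxF : f x *m invmx F = x by rewrite -[in RHS]fxF mulmxKV.
apply: (@incidence_rigid _ _ n2 (fun x => f x *m invmx F)
  (fun u => - g (- u) *m F^T)) x x0.
- move=> x u x0 u0; have u0' : - u != 0 by rewrite oppr_eq0.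
  rewrite dot_mulmxr -mulmxA -trmx_mul mulVmx// trmx1 mulmx1 dotNr.
  split=> xu.
    by rewrite (endo_incidence1 x0 u0') ?opprK// dotNr xu.
  by rewrite (endo_incidence0 x0 u0') ?oppr0// dotNr xu oppr0.
- move=> i; have -> : f (e i) = row i F by rewrite rowK.
  by rewrite -row_mul mulmxV// row1.
- move=> i; have -> : - g (- e i) = row i G by rewrite rowK.
  by rewrite -row_mul GF row1.
Qed.

End Incidence.

(** The action on rays determines [s]: whether [K] contains [x] is read off from the trace of
    [ray x] on [K], and [s] separates [ray x] from every smaller trace. *)
Lemma endo_linear : exists2 F : 'M[R]_n, F \in unitmx &
  forall K, in_PC K -> s K = [set x *m F | x in K].
Proof.
have [x|f hf] := @choice _ _
    (fun x v => x != 0 -> v != 0 /\ s (ray x) = ray v).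
  have [->|x0] := eqVneq x 0; first by exists 0.
  by have [v v0 E] := endo_ray_ray n2 hs nc x0; exists v.
have [u|g hg] := @choice _ _
    (fun u v => u != 0 -> v != 0 /\ s (dual_set (ray u)) = dual_set (ray v)).
  have [->|u0] := eqVneq u 0; first by exists 0.
  by have [v v0 E] := endo_halfspace u0; exists v.
have f0 x : x != 0 -> f x != 0 by move=> /hf[].
have sf x : x != 0 -> s (ray x) = ray (f x) by move=> /hf[].
have sg u : u != 0 -> s (dual_set (ray u)) = dual_set (ray (g u)).
  by move=> /hg[].
have [F uF fE] := endo_rays_linear f0 sf sg.
have sray x : x != 0 -> s (ray x) = ray (x *m F) by move=> x0; rewrite sf ?fE.
exists F => // K PK.
have [->|KT] := pselect (K = setT).
  rewrite endo_setT; apply/seteqP; split=> // y _; exists (y *m invmx F) => //.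
  by rewrite mulmxKV.
have K0 : ~ K 0 by move=> /(in_PC_has0 PK).
have PsK := endo_in_PC hs PK.
have mem x : x != 0 -> K x <-> s K (x *m F).
  move=> x0; have Px := in_PC_ray x0; split=> [Kx|sKx].
    have := endo_sub hs Px PK (ray_sub PK Kx); rewrite sray//; apply.
    exact: ray_self.
  apply: contrapT => nKx.
  have : s (ray x `&` K) = s (ray x).
    by rewrite (endoI hs)//; apply/setIidl; rewrite sray//; exact: ray_sub.
  have [->|[c c1 Ec]] := ray_trace_eq PK K0 x0.
    by move=> E; apply: (endo_ray_neq0 hs n2 nc x0).
  rewrite Ec; apply: (endo_ray_scale_neq hs n2 nc x0).
  rewrite lt_neqAle c1 andbT; apply/eqP => c1'; apply: nKx.
  have [] : (ray x `&` K) x by rewrite Ec -c1' scale1r; exact: ray_self.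
  by [].
apply/seteqP; split=> [y sKy|_ [x Kx <-]]; last first.
  by apply/mem => //; apply/eqP => x0; rewrite x0 in Kx.
exists (y *m invmx F); last by rewrite mulmxKV.
apply/mem; last by rewrite mulmxKV.
(* If [s K] contained the origin it would be the whole space, so [K] would contain every nonzero
   vector and, by convexity, the origin. *)
apply/eqP => x0; apply: K0.
have {}x0 : y = 0 by rewrite -(mulmxKV uF y) x0 mul0mx.
have sT : s K = setT by apply: in_PC_has0 => //; rewrite -x0.
pose e : V := delta_mx 0 (Ordinal n2); have e0 : e != 0 by exact: delta_rV_neq0.
have Ke x : x != 0 -> K x by move=> /mem ->; rewrite sT.
have -> : 0 = 2^-1 *: e + 2^-1 *: - e by rewrite scalerN subrr.
by apply: in_PC_comb => //; [exact: Ke | apply: Ke; rewrite oppr_eq0 | lra..].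
Qed.

End Endo.

Lemma in_PC_preimage (F : 'M[R]_n) K : F \in unitmx -> in_PC K ->
  in_PC [set x | K (x *m F)].
Proof.
move=> uF [[[[k Kk] cK K0 sK] clK]|->|->]; last 2 first.
- exact: in_PC0.
- exact: in_PCT.
apply: Or31; split; last first.
  apply: (@preimage_closed _ _ (fun x : V => x *m F)) => // x _.
  exact: continuous_mulmx.
split.
- by exists (k *m invmx F); rewrite /= mulmxKV.
- apply/convex_subsetP => x y t Kx Ky t01 /=.
  by rewrite mulmxDl -!scalemxAl; move/convex_subsetP: cK; apply.
- by rewrite /= mul0mx.
- by move=> x l Kx l1 /=; rewrite -scalemxAl; exact: sK.
Qed.

Lemma image_mulmx (F : 'M[R]_n) A : F \in unitmx ->
  [set x *m F | x in A] = [set y | A (y *m invmx F)].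
Proof.
move=> uF; apply/seteqP; split=> [_ [x Ax <-]|y Ay] /=; first by rewrite mulmxK.
by exists (y *m invmx F) => //; rewrite mulmxKV.
Qed.

Lemma in_PC_image (F : 'M[R]_n) K : F \in unitmx -> in_PC K ->
  in_PC [set x *m F | x in K].
Proof.
move=> uF PK; rewrite image_mulmx//; apply: in_PC_preimage => //.
by rewrite unitmx_inv.
Qed.

Lemma join_image (F : 'M[R]_n) A B : F \in unitmx -> in_PC A -> in_PC B ->
  join_set [set x *m F | x in A] [set x *m F | x in B] =
  [set x *m F | x in join_set A B].
Proof.
move=> uF PA PB; apply: join_eq.
- exact: in_PC_image.
- exact: in_PC_image.
- exact: in_PC_image uF (in_PC_join PA PB).
- exact/image_subset/join_subl.
- exact/image_subset/join_subr.
- move=> K PK AK BK _ [x Jx <-].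
  apply: (join_sub (in_PC_preimage uF PK) _ _ Jx) => y Ay /=.
    by apply: AK; exists y.
  by apply: BK; exists y.
Qed.

Lemma dual_image (F : 'M[R]_n) A : F \in unitmx ->
  dual_set [set x *m F | x in A] = [set x *m invmx F^T | x in dual_set A].
Proof.
move=> uF; rewrite [RHS]image_mulmx ?unitmx_inv ?unitmx_tr// invmxK.
apply/seteqP; split=> x h y /=.
  by move=> Ay; rewrite dot_mulmxr trmxK; apply: h; exists y.
by move=> [z Az <-]; rewrite dotC dot_mulmxr dotC; exact: h.
Qed.

(** Extends the map to all sets, with the empty set as default value outside the lattice. *)
Definition to_PC A : PC R n :=
  match pselect (in_PC A) with
  | left PA => MkPC PA
  | right _ => MkPC in_PC0
  end.

Lemma to_PCE A : in_PC A -> PC_set (to_PC A) = A.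
Proof. by rewrite /to_PC; case: pselect. Qed.

Lemma PC_setK (K : PC R n) : to_PC (PC_set K) = K.
Proof. by apply: PC_eq; rewrite to_PCE//; exact: PC_setP. Qed.

End Assembly.

Theorem theorem1p1 (R : realType) (n : nat) (hn : (2 <= n)%N)
    (tau : PC R n -> PC R n) :
  (forall K L : PC R n,
     tau (PC_meet K L) = PC_join (tau K) (tau L) /\
     tau (PC_join K L) = PC_meet (tau K) (tau L))
  <->
  (exists C : PC R n, forall K : PC R n, tau K = C) \/
  (exists2 g : 'M[R]_n, g \in unitmx &
     forall K : PC R n,
       PC_set (tau K) = [set x *m g | x in dual_set (PC_set K)]).
Proof.
split; last first.
  move=> [[C tauC] K L|[g ug tauE] K L].
    rewrite !tauC; split; apply: PC_eq => /=; last by rewrite setIid.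
    by apply/esym; apply: join_eq => //; exact: PC_setP.
  have PK := PC_setP K; have PL := PC_setP L.
  have PK' := in_PC_dual PK; have PL' := in_PC_dual PL.
  split; apply: PC_eq; rewrite tauE /= !tauE.
    by rewrite dual_set_meet// join_image.
  by rewrite dual_set_join// !image_mulmx.
move=> tauH; pose s (A : set 'rV[R]_n) := dual_set (PC_set (tau (to_PC A))).
have hs : PC_endo s.
  move=> A B PA PB; rewrite /s.
  have PtA := PC_setP (tau (to_PC A)); have PtB := PC_setP (tau (to_PC B)).
  split; first exact: in_PC_dual.
    have -> : to_PC (A `&` B) = PC_meet (to_PC A) (to_PC B).
      by apply: PC_eq; rewrite /= !to_PCE//; exact: in_PCI.
    by rewrite (tauH _ _).1 /= dual_set_join.
  have -> : to_PC (join_set A B) = PC_join (to_PC A) (to_PC B).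
    by apply: PC_eq; rewrite /= !to_PCE//; exact: in_PC_join.
  by rewrite (tauH _ _).2 /= dual_set_meet.
have tauE K : PC_set (tau K) = dual_set (s (PC_set K)).
  by rewrite /s PC_setK in_PC_bidual//; exact: PC_setP.
(* By monotonicity every image lies between these two. *)
have [E|nc] := pselect (s set0 = s setT).
  left; exists (tau (to_PC set0)) => K; apply: PC_eq; rewrite !tauE.
  rewrite (to_PCE in_PC0); congr dual_set; apply/seteqP; split; last first.
    by apply: (endo_sub hs) => //; [exact: in_PC0 | exact: PC_setP].
  by rewrite E; apply: (endo_sub hs) => //; [exact: PC_setP | exact: in_PCT].
right; have [F uF sE] := endo_linear hn hs nc.
(* Dualizing [s K = K F] turns [F] into its inverse transpose acting on the dual of [K]. *)
exists (invmx F^T); first by rewrite unitmx_inv unitmx_tr.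
by move=> K; rewrite tauE sE ?dual_image//; exact: PC_setP.
Qed.
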